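(* Let $\varphi$ and $\varphi(s,t,x)$ be as in the context, and let $E$ be a subset of $\mathbb{C}$. There exists a divergent formal power series $f(y,t,x)\in\mathbb{C}[[y,t,x]]$ such that $E=\operatorname{Conv}_\varphi(f)$ if and only if $E$ is an $F_\sigma$ set of zero capacity.
   Context: Let $n\ge 1$ and $x=(x_1,\dots,x_n)$. A formal power series $\sum_\alpha a_\alpha z^\alpha$ in finitely many variables is called convergent if there is a constant $C$ with $|a_\alpha|\le C^{|\alpha|}$ for all multi-indices $\alpha\neq 0$ (equivalently, it has a nonempty open polydisc of convergence); otherwise it is divergent. Fix a convergent power series $\varphi(t,x)=\sum_{j\ge1}b_j(x)t^j$, where each $b_j(x)=\sum_{i}b_{ji}x^i\in\mathbb{C}[[x]]$ is convergent (sum over multi-indices $i$), and assume $b_1(0)=b_{10}=1$. For $s\in\mathbb{C}$ put $\varphi(s,t,x)=\varphi_s(t,x)=s\,b_1(x)t+\sum_{j\ge2}b_j(x)t^j$. For $f(y,t,x)\in\mathbb{C}[[y,t,x]]$ ($y,t$ single variables), define $\operatorname{Conv}_\varphi(f)=\{s\in\mathbb{C}: f(\varphi(s,t,x),t,x)\text{ converges as a power series in }(t,x)\}$. Capacity means logarithmic capacity $\mathfrak{c}$ (equal, for compact sets, to the Chebyshev constant / transfinite diameter). An $F_\sigma$ set $E\subset\mathbb{C}$ is said to have zero capacity if $\mathfrak{c}(E\cap\{|z|\le r\})=0$ for every $r\ge0$. *)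

(* Defs.v *)
From Stdlib Require Import Reals List Arith.
Import ListNotations.
Open Scope R_scope.

Definition Cx : Type := (R * R)%type.
Definition Czero : Cx := (0, 0).
Definition Cone : Cx := (1, 0).
Definition Cadd (z w : Cx) : Cx := (fst z + fst w, snd z + snd w).
Definition Copp (z : Cx) : Cx := (- fst z, - snd z).
Definition Csub (z w : Cx) : Cx := Cadd z (Copp w).
Definition Cmul (z w : Cx) : Cx :=
  (fst z * fst w - snd z * snd w, fst z * snd w + snd z * fst w).
Definition Cnorm (z : Cx) : R := sqrt (fst z ^ 2 + snd z ^ 2).
Definition sumC (l : list Cx) : Cx := fold_right Cadd Czero l.

(* ---------- multi-indices (lists of nat; only length-n lists matter) ---------- *)
Definition mdeg (a : list nat) : nat := list_sum a.
Definition mzero (a : list nat) : Prop := Forall (fun k => k = 0%nat) a.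

Fixpoint mle_list (b : list nat) : list (list nat) :=
  match b with
  | [] => [[]]
  | k :: bs => flat_map (fun g => map (fun gs => g :: gs) (mle_list bs)) (seq 0 (S k))
  end.

Fixpoint msub (b g : list nat) : list nat :=
  match b, g with
  | k :: bs, l :: gs => (k - l)%nat :: msub bs gs
  | _, _ => b
  end.

(* series in (t, x): coefficient of t^j x^a *)
Definition ser2 : Type := nat -> list nat -> Cx.
(* series in (y, t, x): coefficient of y^k t^j x^a *)
Definition ser3 : Type := nat -> nat -> list nat -> Cx.

Definition ser_mul (P Q : ser2) : ser2 := fun m b =>
  sumC (flat_map (fun j => map (fun g => Cmul (P j g) (Q (m - j)%nat (msub b g)))
                                (mle_list b)) (seq 0 (S m))).

Definition ser_one : ser2 := fun m b =>
  if andb (Nat.eqb m 0) (forallb (Nat.eqb 0) b) then Cone else Czero.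

Fixpoint ser_pow (P : ser2) (k : nat) : ser2 :=
  match k with
  | O => ser_one
  | S k' => ser_mul P (ser_pow P k')
  end.

(* f(P(t,x), t, x) for P without t^0-term: coefficient of t^m x^b.
   Since P^k = O(t^k), only k <= m contributes. *)
Definition ser_subst (f : ser3) (P : ser2) : ser2 := fun m b =>
  sumC (map (fun k => ser_mul (f k) (ser_pow P k) m b) (seq 0 (S m))).

Definition convergent_x (n : nat) (g : list nat -> Cx) : Prop :=
  exists Cst : R, forall a, length a = n -> ~ mzero a ->
    Cnorm (g a) <= Cst ^ (mdeg a).

Definition convergent2 (n : nat) (P : ser2) : Prop :=
  exists Cst : R, forall j a, length a = n -> ~ (j = 0%nat /\ mzero a) ->
    Cnorm (P j a) <= Cst ^ (j + mdeg a).

Definition convergent3 (n : nat) (f : ser3) : Prop :=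
  exists Cst : R, forall k j a, length a = n -> ~ (k = 0%nat /\ j = 0%nat /\ mzero a) ->
    Cnorm (f k j a) <= Cst ^ (k + j + mdeg a).

Definition phi_ser (b : nat -> list nat -> Cx) : ser2 := fun j a =>
  match j with O => Czero | _ => b j a end.

Definition phi_s (b : nat -> list nat -> Cx) (s : Cx) : ser2 := fun j a =>
  match j with
  | O => Czero
  | 1%nat => Cmul s (b 1%nat a)
  | _ => b j a
  end.

Definition Conv (n : nat) (b : nat -> list nat -> Cx) (f : ser3) (s : Cx) : Prop :=
  convergent2 n (ser_subst f (phi_s b s)).

Definition closedC (S : Cx -> Prop) : Prop :=
  forall z, ~ S z -> exists d, 0 < d /\ forall w, Cnorm (Csub w z) < d -> ~ S w.
Definition boundedC (S : Cx -> Prop) : Prop :=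
  exists M, forall z, S z -> Cnorm z <= M.
Definition compactC (S : Cx -> Prop) : Prop := closedC S /\ boundedC S.
Definition Fsigma (E : Cx -> Prop) : Prop :=
  exists F : nat -> Cx -> Prop, (forall k, closedC (F k)) /\
    forall z, E z <-> exists k, F k z.

Fixpoint prodR (f : nat -> R) (m : nat) : R :=
  match m with O => 1 | S m' => prodR f m' * f m' end.
Definition vandermonde_abs (z : nat -> Cx) (m : nat) : R :=
  prodR (fun j => prodR (fun i => Cnorm (Csub (z i) (z j))) j) m.

(* transfinite diameter d(K) = lim_m d_m with
   d_m = (sup_{z_1..z_m in K} prod_{i<j} |z_i - z_j|)^(2/(m(m-1))).
   d(K) = 0  <->  forall eps>0, eventually d_m <= eps
             <->  eventually all products <= eps^(m(m-1)/2). *)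
Definition transfinite_diameter_zero (K : Cx -> Prop) : Prop :=
  forall eps, 0 < eps -> exists N : nat, forall m : nat, (2 <= m)%nat -> (N <= m)%nat ->
    forall z : nat -> Cx, (forall i, (i < m)%nat -> K (z i)) ->
      vandermonde_abs z m <= eps ^ (m * (m - 1) / 2).

(* capacity of a (Borel) set = inner capacity = sup over compact subsets;
   for compact sets capacity = transfinite diameter. *)
Definition capacity_zero (S : Cx -> Prop) : Prop :=
  forall K, compactC K -> (forall z, K z -> S z) -> transfinite_diameter_zero K.

Definition Fsigma_zero_capacity (E : Cx -> Prop) : Prop :=
  Fsigma E /\ forall r, 0 <= r -> capacity_zero (fun z => E z /\ Cnorm z <= r).

(* Main.v *)
(* Substituting y = phi_s = t (psi + s b_1) into f gives a series in (t, x) whose coefficient of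
   t^m x^a is a polynomial of degree at most m in s.

   Necessity.  The set E_N of those s for which every such coefficient is at most N^(m+|a|) is
   closed, and the convergence set is the union of the E_N.  If a compact subset K of it has
   positive transfinite diameter, then some K /\ E_N has a positive Chebyshev constant: otherwise
   weighted products of Chebyshev polynomials of finitely many E_N would be small on all of K.
   Lagrange interpolation of f(phi_s) at nearly Fekete points of K /\ E_N, where the denominators
   are only exponentially small, then bounds the coefficients of f geometrically.

   Sufficiency.  Let E be the increasing union of compact sets E_N of capacity zero.  For each
   pair (N, k) take a monic polynomial q with d roots in E_N which is tiny on E_N, and put
   D = (k+1) d.  The series f is the sum over all pairs, with D lacunary, of
   2^((N+1)D) t^(D-d) prod (y - phi_w) over the roots w of q.  Then f(phi_s) is the sum of the
   2^((N+1)D) q(s) t^D b_1^d.  Since the degree d is small compared with the power D of t, the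
   terms with N below a given bound grow at most geometrically on every disc, uniformly in k,
   while at distance 1/(k+1) from E_N the term of (N, k) is at least 2^(ND). *)

Require Import Defs.
From Stdlib Require Import Reals List Arith Lia Lra Psatz Permutation Cantor.
From Stdlib Require Import FunctionalExtensionality ClassicalEpsilon Classical.
From Coquelicot Require Import Complex.
Import ListNotations.
Open Scope R_scope.

(** * Finite sums *)

(** Necessity rests on putting [y = t u]: then [y = phi_s] reads [u = psi + s b_1], that is,
    [s = (u - psi) / b_1]. Interpolating [f(phi_s, t, x)] in [s] and evaluating at this quotient
    recovers [f(t u, t, x)]. To avoid the division, Lagrange's formula is homogenised; it then
    yields [b_1^d] times the part of [f(t u, t, x)] of degree at most [d] in [u]. Since
    [b_1(0) = 1], the series [b_1] is within 1/2 of 1 in a suitable norm, and the power is removed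
    at the cost of a factor [2^d]. The monomial [y^k t^j] turns into [u^k t^(k+j)], so [d = k + j]
    reaches its coefficient. The norms are weighted sums over a finite box of multi-indices: they
    are submultiplicative and bounded uniformly in the box, so that only finite sums occur. In the
    sufficiency part one series must serve all [N] and all distances at once. The base [2^(N+1)] of
    the coefficient depends on [N] alone, which keeps the growth in [k] geometric in [D], and
    bounding [q] on [E_N] by [2^(-(N+1)(k+1)d) = 2^(-(N+1)D)] cancels the coefficient exactly
    there. *)

Fixpoint csum (f : nat -> C) (n : nat) : C :=
  match n with O => 0%C | S m => (csum f m + f m)%C end.

Fixpoint rsum (f : nat -> R) (n : nat) : R :=
  match n with O => 0 | S m => rsum f m + f m end.

Lemma csum_ext (f g : nat -> C) n :
  (forall i, (i < n)%nat -> f i = g i) -> csum f n = csum g n.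
Proof.
  induction n as [|n IH]; intros H; simpl; [reflexivity|].
  rewrite IH, H; auto.
Qed.

Lemma csum_zero (f : nat -> C) n :
  (forall i, (i < n)%nat -> f i = 0%C) -> csum f n = 0%C.
Proof.
  induction n as [|n IH]; intros H; simpl; [reflexivity|].
  rewrite IH, H by auto. ring.
Qed.

Lemma csum_add (f g : nat -> C) n :
  csum (fun i => (f i + g i)%C) n = (csum f n + csum g n)%C.
Proof. induction n as [|n IH]; simpl; [ring|]. rewrite IH. ring. Qed.

Lemma csum_exchange (F : nat -> nat -> C) n m :
  csum (fun i => csum (fun j => F i j) m) n = csum (fun j => csum (fun i => F i j) n) m.
Proof.
  induction n as [|n IH]; simpl.
  - symmetry. apply csum_zero. reflexivity.
  - rewrite IH, <- csum_add. reflexivity.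
Qed.

Lemma csum_first (f : nat -> C) n :
  csum f (S n) = (f 0%nat + csum (fun i => f (S i)) n)%C.
Proof.
  induction n as [|n IH]; [simpl; ring|].
  change (csum f (S (S n))) with (csum f (S n) + f (S n))%C.
  rewrite IH. simpl. ring.
Qed.

Lemma csum_only (f : nat -> C) n i :
  (i < n)%nat -> (forall j, (j < n)%nat -> j <> i -> f j = 0%C) -> csum f n = f i.
Proof.
  induction n as [|n IH]; intros Hi H; [lia|]. simpl.
  destruct (Nat.eq_dec i n) as [->|Hne].
  - rewrite csum_zero; [ring|]. intros j Hj. apply H; lia.
  - rewrite IH, (H n); try lia; [ring|]. intros; apply H; lia.
Qed.

Lemma csum_extend (f : nat -> C) n m :
  (n <= m)%nat -> (forall i, (n <= i < m)%nat -> f i = 0%C) -> csum f m = csum f n.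
Proof.
  induction 1 as [|m Hm IH]; intros H; [reflexivity|]. simpl.
  rewrite IH, H by (auto || intros; apply H; lia || lia). ring.
Qed.

Lemma csum_rev (f : nat -> C) k :
  csum f (S k) = csum (fun j => f (k - j)%nat) (S k).
Proof.
  induction k as [|k IH]; [reflexivity|].
  rewrite csum_first with (f := fun j => f (S k - j)%nat).
  change (csum f (S (S k))) with (csum f (S k) + f (S k))%C.
  rewrite IH. simpl Nat.sub. ring.
Qed.

(** Passing from [k] to [S k] adds the antidiagonal [i + j = S k] to both sides. This reindexing is
    what associativity of the Cauchy product comes down to. *)
Lemma csum_triangle (F : nat -> nat -> C) k :
  csum (fun j => csum (fun i => F i (j - i)%nat) (S j)) (S k) =
  csum (fun i => csum (fun j => F i j) (S (k - i))) (S k).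
Proof.
  induction k as [|k IH]; [reflexivity|].
  change (csum (fun j => csum (fun i => F i (j - i)%nat) (S j)) (S (S k))) with
    (csum (fun j => csum (fun i => F i (j - i)%nat) (S j)) (S k)
     + csum (fun i => F i (S k - i)%nat) (S (S k)))%C.
  rewrite IH.
  change (csum (fun i => F i (S k - i)%nat) (S (S k))) with
    (csum (fun i => F i (S k - i)%nat) (S k) + F (S k) (S k - S k)%nat)%C.
  change (csum (fun i => csum (fun j => F i j) (S (S k - i))) (S (S k))) with
    (csum (fun i => csum (fun j => F i j) (S (S k - i))) (S k)
     + csum (fun j => F (S k) j) (S (S k - S k)))%C.
  rewrite (csum_ext (fun i => csum (fun j => F i j) (S (S k - i)))
             (fun i => csum (fun j => F i j) (S (k - i)) + F i (S k - i)%nat)%C).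
  2:{ intros i Hi. replace (S k - i)%nat with (S (k - i)) by lia. reflexivity. }
  rewrite csum_add, Nat.sub_diag. simpl. ring.
Qed.

Lemma rsum_le (f g : nat -> R) n :
  (forall i, (i < n)%nat -> f i <= g i) -> rsum f n <= rsum g n.
Proof.
  induction n as [|n IH]; intros H; simpl; [lra|].
  apply Rplus_le_compat; auto.
Qed.

Lemma rsum_nonneg (f : nat -> R) n : (forall i, 0 <= f i) -> 0 <= rsum f n.
Proof. induction n; intros H; simpl; [lra|]. specialize (H n) as H'. specialize (IHn H). lra. Qed.

Lemma rsum_add (f g : nat -> R) n : rsum (fun i => f i + g i) n = rsum f n + rsum g n.
Proof. induction n as [|n IH]; simpl; [ring|]. rewrite IH. ring. Qed.

Lemma rsum_scal c (f : nat -> R) n : rsum (fun i => c * f i) n = c * rsum f n.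
Proof. induction n as [|n IH]; simpl; [ring|]. rewrite IH. ring. Qed.

Lemma rsum_first (f : nat -> R) n : rsum f (S n) = f 0%nat + rsum (fun i => f (S i)) n.
Proof.
  induction n as [|n IH]; [simpl; ring|].
  change (rsum f (S (S n))) with (rsum f (S n) + f (S n)).
  rewrite IH. simpl. ring.
Qed.

(* The pairs [(i, j - i)] with [i <= j <= k] all lie in the square [0..k]^2. *)
Lemma rsum_convolution_le (f g : nat -> R) k :
  (forall i, 0 <= f i) -> (forall i, 0 <= g i) ->
  rsum (fun j => rsum (fun i => f i * g (j - i)%nat) (S j)) (S k)
  <= rsum f (S k) * rsum g (S k).
Proof.
  intros Hf Hg. revert f Hf. induction k as [|k IH]; intros f Hf; [simpl; lra|].
  rewrite rsum_first.
  rewrite (rsum_first f).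
  apply Rle_trans with
    (f 0%nat * g 0%nat + (f 0%nat * rsum (fun i => g (S i)) (S k)
     + rsum (fun i => f (S i)) (S k) * rsum g (S k))).
  - simpl rsum at 1. rewrite Rplus_0_l. apply Rplus_le_compat_l.
    rewrite <- rsum_scal.
    eapply Rle_trans; [|apply Rplus_le_compat_l, (IH (fun i => f (S i))); auto].
    rewrite <- rsum_add. apply rsum_le. intros j Hj.
    rewrite rsum_first, Nat.sub_0_r. simpl Nat.sub. lra.
  - assert (H1 := rsum_first g (S k)).
    assert (rsum (fun i => f (S i)) (S k) * rsum g (S k) <=
            rsum (fun i => f (S i)) (S k) * rsum g (S (S k))).
    { apply Rmult_le_compat_l; [apply rsum_nonneg; auto|].
      change (rsum g (S (S k))) with (rsum g (S k) + g (S k)). specialize (Hg (S k)). lra. }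
    rewrite H1 in *. nra.
Qed.

(** * The ring of formal power series *)

(* A series in [n] variables is read off the multi-indices of length [n]; the same type
   serves all [n], and a series is determined by its values on all lists. *)
Definition ser : Type := list nat -> C.

Definition slice (P : ser) (j : nat) : ser := fun g => P (j :: g).

(** The Cauchy product, taken one variable at a time: a series is seen as a one-variable series in
    the leading variable with its slices as coefficients. Each ring law thus reduces to one-variable
    sums and an induction on the multi-index. *)
Fixpoint smul_at (b : list nat) (P Q : ser) : C :=
  match b with
  | [] => (P [] * Q [])%C
  | k :: b' => csum (fun j => smul_at b' (slice P j) (slice Q (k - j))) (S k)
  end.

Lemma smul_at_cons k b P Q :
  smul_at (k :: b) P Q = csum (fun j => smul_at b (slice P j) (slice Q (k - j))) (S k).
Proof. reflexivity. Qed.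

Definition smul (P Q : ser) : ser := fun b => smul_at b P Q.
Definition sadd (P Q : ser) : ser := fun b => (P b + Q b)%C.
Definition sopp (P : ser) : ser := fun b => (- P b)%C.
Definition ssub (P Q : ser) : ser := sadd P (sopp Q).
Definition sc (c : C) : ser := fun b => if forallb (Nat.eqb 0) b then c else 0%C.

Declare Scope ser_scope.
Delimit Scope ser_scope with ser.
Bind Scope ser_scope with ser.
Infix "+" := sadd : ser_scope.
Infix "-" := ssub : ser_scope.
Infix "*" := smul : ser_scope.

(** Only coefficients at multi-indices below [b] enter. This locality later lets an infinite sum of
    series be replaced by a finite truncation inside a product. *)
Lemma smul_at_ext b : forall P P' Q Q' : ser,
  (forall g, Forall2 le g b -> P g = P' g) ->
  (forall g, Forall2 le g b -> Q g = Q' g) -> smul_at b P Q = smul_at b P' Q'.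
Proof.
  induction b as [|k b IH]; intros P P' Q Q' HP HQ; [|rewrite ?smul_at_cons].
  - simpl; rewrite HP, HQ by constructor. reflexivity.
  - apply csum_ext. intros j Hj. apply IH; intros g Hg;
      [apply HP | apply HQ]; constructor; auto; lia.
Qed.

Lemma smul_at_add_l b : forall P P' Q : ser,
  smul_at b (sadd P P') Q = (smul_at b P Q + smul_at b P' Q)%C.
Proof.
  induction b as [|k b IH]; intros P P' Q; [unfold sadd; simpl; ring|rewrite ?smul_at_cons].
  rewrite <- csum_add. apply csum_ext. intros j Hj. apply IH.
Qed.

Lemma smul_at_sc b : forall (c : C) (P : ser), smul_at b (sc c) P = (c * P b)%C.
Proof.
  induction b as [|k b IH]; intros c P; [reflexivity|]. rewrite ?smul_at_cons.
  rewrite csum_first, csum_zero, Nat.sub_0_r.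
  - change (slice (sc c) 0) with (sc c). rewrite IH. unfold slice. ring.
  - intros j Hj. change (slice (sc c) (S j)) with (fun _ : list nat => RtoC 0).
    rewrite (smul_at_ext b (fun _ => RtoC 0) (sc 0%C) _ (slice P (k - S j))).
    + rewrite IH. ring.
    + intros. unfold sc. destruct (forallb _ _); reflexivity.
    + reflexivity.
Qed.

Lemma smul_at_comm b : forall P Q : ser, smul_at b P Q = smul_at b Q P.
Proof.
  induction b as [|k b IH]; intros P Q; [simpl; ring|]. rewrite ?smul_at_cons.
  rewrite csum_rev. apply csum_ext. intros j Hj.
  rewrite IH. replace (k - (k - j))%nat with j by lia. reflexivity.
Qed.

Lemma smul_at_csum_l b : forall (F : nat -> ser) n Q,
  smul_at b (fun g => csum (fun i => F i g) n) Q = csum (fun i => smul_at b (F i) Q) n.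
Proof.
  intros F n Q. induction n as [|n IH]; simpl csum.
  - transitivity (smul_at b (sc 0%C) Q).
    + apply smul_at_ext; [|reflexivity]. intros. unfold sc. destruct (forallb _ _); reflexivity.
    + rewrite smul_at_sc. ring.
  - rewrite <- IH, <- smul_at_add_l. reflexivity.
Qed.

Lemma smul_at_assoc b : forall P Q T : ser,
  smul_at b P (smul Q T) = smul_at b (smul P Q) T.
Proof.
  induction b as [|k b IH]; intros P Q T; [simpl; unfold smul; simpl; ring|].
  rewrite ?smul_at_cons.
  transitivity (csum (fun j => csum (fun i =>
      smul_at b (smul (slice P i) (slice Q (j - i))) (slice T (k - i - (j - i)))) (S j)) (S k)).
  - rewrite (csum_triangle (fun i j => smul_at b (smul (slice P i) (slice Q j)) (slice T (k - i - j)))).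
    apply csum_ext. intros i Hi. rewrite smul_at_comm.
    change (slice (smul Q T) (k - i)) with
      (fun g => csum (fun j => smul (slice Q j) (slice T (k - i - j)) g) (S (k - i))).
    rewrite smul_at_csum_l. apply csum_ext. intros j Hj.
    rewrite smul_at_comm. apply IH.
  - apply csum_ext. intros j Hj.
    change (slice (smul P Q) j) with
      (fun g => csum (fun i => smul (slice P i) (slice Q (j - i)) g) (S j)).
    rewrite smul_at_csum_l. apply csum_ext. intros i Hi.
    replace (k - i - (j - i))%nat with (k - j)%nat by lia. reflexivity.
Qed.

Lemma ser_ring_theory : ring_theory (sc 0%C) (sc 1%C) sadd smul ssub sopp (@eq ser).
Proof.
  assert (H0 : forall b, sc 0%C b = 0%C)
    by (intros; unfold sc; destruct (forallb _ _); reflexivity).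
  constructor; intros; extensionality g;
    unfold sadd, sopp, ssub, sadd, smul; rewrite ?H0; try ring.
  - rewrite smul_at_sc. ring.
  - apply smul_at_comm.
  - apply smul_at_assoc.
  - apply smul_at_add_l.
  - reflexivity.
Qed.

Add Ring ser_ring : ser_ring_theory.

Lemma smul_sc_at c P b : (sc c * P)%ser b = (c * P b)%C.
Proof. apply smul_at_sc. Qed.

Lemma sc_mul c d : sc (c * d)%C = (sc c * sc d)%ser.
Proof.
  extensionality g. unfold smul. rewrite smul_at_sc. unfold sc.
  destruct (forallb _ _); ring.
Qed.

Lemma sc_sub c d : sc (c - d)%C = (sc c - sc d)%ser.
Proof.
  extensionality g. unfold ssub, sadd, sopp, sc. destruct (forallb _ _); ring.
Qed.

Lemma sc_0_at b : sc 0%C b = 0%C.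
Proof. unfold sc. destruct (forallb _ _); reflexivity. Qed.

Lemma smul_at_zero_l b (P Q : ser) : (forall g, P g = 0%C) -> smul_at b P Q = 0%C.
Proof.
  intros HP. replace P with (sc 0%C) by (extensionality g; rewrite sc_0_at; auto).
  rewrite smul_at_sc. ring.
Qed.

Lemma sc_mul_cancel (c : C) P Q : c <> 0%C -> (sc c * P = sc c * Q)%ser -> P = Q.
Proof.
  intros Hc H. extensionality g. apply (f_equal (fun T : ser => T g)) in H.
  unfold smul in H. rewrite !smul_at_sc in H.
  replace (P g) with (/ c * (c * P g))%C by (field; auto). rewrite H. field. auto.
Qed.

Fixpoint spow (P : ser) (k : nat) : ser :=
  match k with O => sc 1%C | S k' => (P * spow P k')%ser end.

Definition sprod (l : list ser) : ser := fold_right smul (sc 1%C) l.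
Definition ssum (l : list ser) : ser := fold_right sadd (sc 0%C) l.

Lemma sprod_cons P l : sprod (P :: l) = (P * sprod l)%ser.
Proof. reflexivity. Qed.

Lemma sprod_app l l' : sprod (l ++ l') = (sprod l * sprod l')%ser.
Proof. induction l as [|P l IH]; simpl; [ring|]. rewrite IH. ring. Qed.

Lemma sprod_repeat P k : sprod (repeat P k) = spow P k.
Proof. induction k as [|k IH]; simpl; [reflexivity|]. rewrite IH. reflexivity. Qed.

Lemma spow_mul P Q k : spow (P * Q)%ser k = (spow P k * spow Q k)%ser.
Proof. induction k as [|k IH]; simpl; [ring|]. rewrite IH. ring. Qed.

Lemma spow_add P j k : spow P (j + k) = (spow P j * spow P k)%ser.
Proof. induction j as [|j IH]; simpl; [ring|]. rewrite IH. ring. Qed.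

(** * Adjoining a variable *)

(* In both definitions the value at [[]] only serves to make the ring identities hold
   on all lists. *)
Definition lift (P : ser) : ser := fun l =>
  match l with [] => P [] | k :: l' => if Nat.eqb k 0 then P l' else 0%C end.

Definition sX : ser := fun l =>
  match l with [] => 0%C | k :: l' => if Nat.eqb k 1 then sc 1%C l' else 0%C end.

Lemma smul_lift_cons P Q k l : (lift P * Q)%ser (k :: l) = (P * slice Q k)%ser l.
Proof.
  unfold smul. rewrite ?smul_at_cons. rewrite csum_first, csum_zero, Nat.sub_0_r.
  - change (slice (lift P) 0) with P. ring.
  - intros j Hj. apply smul_at_zero_l. reflexivity.
Qed.

Lemma smul_sX_cons P k l :
  (sX * P)%ser (k :: l) = match k with O => 0%C | S k' => P (k' :: l) end.
Proof.
  unfold smul. rewrite ?smul_at_cons.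
  destruct k as [|k].
  - simpl csum. rewrite smul_at_zero_l by reflexivity. ring.
  - rewrite (csum_only _ _ 1%nat); [|lia|].
    + change (slice sX 1) with (sc 1%C). rewrite smul_at_sc.
      simpl Nat.sub. rewrite Nat.sub_0_r. unfold slice. ring.
    + intros [|[|j]] Hj Hne; try lia; apply smul_at_zero_l; reflexivity.
Qed.

Lemma smul_sX_nil P : (sX * P)%ser [] = 0%C.
Proof. unfold smul. simpl. ring. Qed.

Lemma spow_sX_mul_cons P d k l :
  (spow sX d * P)%ser (k :: l) = if Nat.leb d k then P ((k - d)%nat :: l) else 0%C.
Proof.
  revert k. induction d as [|d IH]; intros k.
  - replace (spow sX 0 * P)%ser with P by (simpl; ring). rewrite Nat.sub_0_r. reflexivity.
  - replace (spow sX (S d) * P)%ser with (sX * (spow sX d * P))%ser by (simpl; ring).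
    rewrite smul_sX_cons. destruct k as [|k]; [reflexivity|]. apply IH.
Qed.

Lemma lift_mul P Q : lift (P * Q)%ser = (lift P * lift Q)%ser.
Proof.
  extensionality l. destruct l as [|k l]; [reflexivity|].
  rewrite smul_lift_cons. destruct k as [|k]; [reflexivity|].
  unfold smul. rewrite smul_at_comm, smul_at_zero_l; reflexivity.
Qed.

Lemma lift_add P Q : lift (P + Q)%ser = (lift P + lift Q)%ser.
Proof.
  extensionality l. unfold sadd.
  destruct l as [|[|k] l]; simpl; [reflexivity|reflexivity|ring].
Qed.

Lemma lift_sc c : lift (sc c) = sc c.
Proof. extensionality l. destruct l as [|[|k] l]; reflexivity. Qed.

Lemma lift_spow P k : lift (spow P k) = spow (lift P) k.
Proof.
  induction k as [|k IH]; simpl; [apply lift_sc|]. rewrite lift_mul, IH. reflexivity.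
Qed.

(** * Lagrange interpolation in homogeneous form *)

(** The index set of Lagrange's formula: a node together with the other nodes. Nodes are removed by
    position, so equality of complex numbers never has to be decided. *)
Fixpoint sel (Z : list C) : list (C * list C) :=
  match Z with
  | [] => []
  | z :: Z' => (z, Z') :: map (fun p => (fst p, z :: snd p)) (sel Z')
  end.

Lemma sel_perm Z z r : In (z, r) (sel Z) -> Permutation Z (z :: r).
Proof.
  revert z r. induction Z as [|z0 Z IH]; intros z r; simpl; [tauto|].
  intros [[= -> ->]|H]; [reflexivity|].
  apply in_map_iff in H as [[z1 r1] [[= -> <-] H]]. simpl.
  rewrite (IH _ _ H). constructor.
Qed.

Lemma length_sel Z : length (sel Z) = length Z.
Proof. induction Z as [|z Z IH]; simpl; [reflexivity|]. rewrite length_map, IH. reflexivity. Qed.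

Section Interpolation.
Variables kappa mu : ser.

(** The factor [s - w] at [s = kappa / mu], multiplied by [mu]. Keeping numerator and denominator
    apart avoids inverting [mu] and admits [mu = 0], the point at infinity, where interpolation
    reads off a leading coefficient. *)
Definition node_form (w : C) : ser := (kappa - mu * sc w)%ser.
Definition node_ratio (z w : C) : ser := (sc (/ (z - w))%C * node_form w)%ser.

Definition interp (h : C -> ser) (Z : list C) : ser :=
  ssum (map (fun p => (h (fst p) * sprod (map (node_ratio (fst p)) (snd p)))%ser) (sel Z)).

Lemma interp_cons h z Z :
  interp h (z :: Z) =
  (h z * sprod (map (node_ratio z) Z) + interp (fun x => (h x * node_ratio x z)%ser) Z)%ser.
Proof.
  unfold interp. simpl. f_equal. rewrite map_map. f_equal. apply map_ext.
  intros [x r]; simpl. ring.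
Qed.

Lemma interp_ext h h' Z : (forall z, In z Z -> h z = h' z) -> interp h Z = interp h' Z.
Proof.
  intros H. unfold interp. f_equal. apply map_ext_in. intros [z r] Hz. simpl.
  rewrite H; [reflexivity|].
  eapply Permutation_in; [symmetry; apply (sel_perm _ _ _ Hz)|now left].
Qed.

Lemma interp_add h h' Z :
  interp (fun z => (h z + h' z)%ser) Z = (interp h Z + interp h' Z)%ser.
Proof.
  unfold interp. induction (sel Z) as [|p L IH]; simpl; [ring|]. rewrite IH. ring.
Qed.

Lemma interp_scal c h Z : interp (fun z => (c * h z)%ser) Z = (c * interp h Z)%ser.
Proof.
  unfold interp. induction (sel Z) as [|p L IH]; simpl; [ring|]. rewrite IH. ring.
Qed.

(* Neville's recursion. *)
Lemma interp_neville h z0 z1 Z :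
  NoDup (z0 :: z1 :: Z) ->
  (sc (z1 - z0)%C * interp h (z0 :: z1 :: Z))%ser =
  (node_form z0 * interp h (z1 :: Z) - node_form z1 * interp h (z0 :: Z))%ser.
Proof.
  intros Hnd. rewrite !interp_cons. simpl map.
  inversion_clear Hnd as [|? ? Hz0 Hnd']. inversion_clear Hnd' as [|? ? Hz1 _].
  assert (H01 : (z1 - z0 <> 0)%C) by (intros H; apply Hz0; left; now apply Ceq_minus).
  assert (H10 : (z0 - z1 <> 0)%C) by (intros H; apply Hz0; left; symmetry; now apply Ceq_minus).
  assert (E1 : (sc (z1 - z0)%C * sc (/ (z1 - z0))%C = sc 1%C)%ser)
    by (rewrite <- sc_mul; f_equal; field; auto).
  assert (E0 : (sc (z1 - z0)%C * sc (/ (z0 - z1))%C = sopp (sc 1%C))%ser).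
  { transitivity (sc 0%C - sc 1%C)%ser; [|ring].
    rewrite <- sc_mul, <- sc_sub. f_equal. field. auto. }
  set (I2 := interp (fun x => (h x * node_ratio x z0 * node_ratio x z1)%ser) Z).
  (* The nodes other than [z0] and [z1] are matched by partial fractions in [x]. *)
  assert (HI : (sc (z1 - z0)%C * I2)%ser =
     (node_form z0 * interp (fun x => (h x * node_ratio x z1)%ser) Z
      - node_form z1 * interp (fun x => (h x * node_ratio x z0)%ser) Z)%ser).
  { unfold I2. rewrite <- !interp_scal.
    transitivity (interp (fun z => (node_form z0 * (h z * node_ratio z z1) +
       (sopp (node_form z1)) * (h z * node_ratio z z0))%ser) Z).
    - apply interp_ext. intros x Hx.
      assert (x - z0 <> 0)%C
        by (intros H; apply Hz0; right; apply Ceq_minus in H; now subst).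
      assert (x - z1 <> 0)%C
        by (intros H'; apply Hz1; apply Ceq_minus in H'; now subst).
      assert (E : (sc (z1 - z0)%C * sc (/ (x - z0))%C * sc (/ (x - z1))%C
                   = sc (/ (x - z1))%C - sc (/ (x - z0))%C)%ser).
      { rewrite <- !sc_mul, <- sc_sub. f_equal. field. auto. }
      unfold node_ratio.
      transitivity (h x * node_form z0 * node_form z1 *
        (sc (z1 - z0)%C * sc (/ (x - z0))%C * sc (/ (x - z1))%C))%ser; [ring|].
      rewrite E. ring.
    - rewrite interp_add, !interp_scal. ring. }
  simpl sprod. set (p0 := sprod _). set (p1 := sprod _).
  transitivity (h z0 * node_form z1 * p0 * (sc (z1 - z0)%C * sc (/ (z0 - z1))%C)
     + h z1 * node_form z0 * p1 * (sc (z1 - z0)%C * sc (/ (z1 - z0))%C)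
     + sc (z1 - z0)%C * I2)%ser.
  - change (interp (fun x => (h x * node_ratio x z0 * node_ratio x z1)%ser) Z) with I2.
    unfold node_ratio. ring.
  - rewrite E0, E1, HI. ring.
Qed.

Definition form_at (z : C) (p : ser * ser) : ser := (fst p + snd p * sc z)%ser.

(** A product of [d] linear forms in [z] has degree at most [d], so [d + 1] nodes reproduce it,
    homogenised to degree [d]. The induction is on the forms, splitting [al + be z] as
    [(al + be z0) + be (z - z0)]. *)
Lemma interp_forms l : forall Z, NoDup Z -> length Z = S (length l) ->
  interp (fun z => sprod (map (form_at z) l)) Z =
  sprod (map (fun p => (fst p * mu + snd p * kappa)%ser) l).
Proof.
  induction l as [|[al be] l IH]; intros [|z0 Z] Hnd Hlen; try discriminate.
  - destruct Z; [|discriminate]. unfold interp. simpl. ring.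
  - destruct Z as [|z1 Z]; [discriminate|].
    assert (H01 : (z1 - z0 <> 0)%C).
    { intros H. apply Ceq_minus in H. subst. inversion_clear Hnd as [|? ? H _].
      apply H. now left. }
    assert (Hnd1 : NoDup (z1 :: Z)) by now inversion Hnd.
    assert (Hnd0 : NoDup (z0 :: Z)).
    { inversion_clear Hnd as [|? ? H H']. inversion_clear H'. constructor; auto.
      intros Hin. apply H. now right. }
    set (h := fun z => sprod (map (form_at z) l)).
    set (q := sprod (map (fun p => (fst p * mu + snd p * kappa)%ser) l)).
    assert (IH1 : interp h (z1 :: Z) = q) by (apply IH; simpl in *; auto; lia).
    assert (IH0 : interp h (z0 :: Z) = q) by (apply IH; simpl in *; auto; lia).
    (* One node too many only raises the degree of homogeneity: in Neville's recursion both smaller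
       interpolants equal [q], and the two node forms differ by [mu (z1 - z0)]. *)
    assert (Hpad : interp h (z0 :: z1 :: Z) = (mu * q)%ser).
    { assert (HN := interp_neville h _ _ _ Hnd).
      rewrite IH0, IH1 in HN.
      replace (node_form z0 * q - node_form z1 * q)%ser
        with (sc (z1 - z0)%C * (mu * q))%ser in HN
        by (unfold node_form; rewrite sc_sub; ring).
      exact (sc_mul_cancel _ _ _ H01 HN). }
    (* The factor [z - z0] kills the term at [z0]; in the other terms it cancels the denominator
       belonging to [z0]. *)
    assert (Hkill : interp (fun z => ((sc z - sc z0) * h z)%ser) (z0 :: z1 :: Z)
                    = (node_form z0 * q)%ser).
    { rewrite interp_cons. transitivity (interp (fun x => (node_form z0 * h x)%ser) (z1 :: Z)).
      - replace (sc z0 - sc z0)%ser with (sc 0%C) by ring.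
        rewrite <- (ser_ring_theory.(Radd_0_l) (interp (fun x => (node_form z0 * h x)%ser) (z1 :: Z))).
        f_equal; [ring|]. apply interp_ext. intros x Hx. unfold node_ratio.
        assert (x - z0 <> 0)%C.
        { intros H; apply Ceq_minus in H; subst. inversion Hnd; auto. }
        transitivity (node_form z0 * h x * (sc (x - z0)%C * sc (/ (x - z0))%C))%ser.
        + rewrite sc_sub. ring.
        + rewrite <- sc_mul. replace ((x - z0) * / (x - z0))%C with (RtoC 1) by (field; auto). ring.
      - rewrite interp_scal. f_equal. exact IH1. }
    simpl map. simpl sprod. fold q.
    transitivity (interp (fun z => ((al + be * sc z0) * h z + be * ((sc z - sc z0) * h z))%ser)
                    (z0 :: z1 :: Z)).
    + apply interp_ext. intros z _. unfold h, form_at. simpl. ring.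
    + rewrite interp_add, !interp_scal, Hpad, Hkill. simpl. unfold node_form. ring.
Qed.

End Interpolation.

(** * Truncated weighted norms *)

(* [snorm rho b P] is the sum of [|P_g| rho^|g|] over the multi-indices [g <= b]. *)
Fixpoint snorm (rho : R) (b : list nat) (P : ser) : R :=
  match b with
  | [] => Cmod (P [])
  | k :: b' => rsum (fun j => rho ^ j * snorm rho b' (slice P j)) (S k)
  end.

Lemma snorm_cons rho k b P :
  snorm rho (k :: b) P = rsum (fun j => rho ^ j * snorm rho b (slice P j)) (S k).
Proof. reflexivity. Qed.

Section Norm.
Variable rho : R.
Hypothesis rho_pos : 0 < rho.

Lemma snorm_nonneg b : forall P, 0 <= snorm rho b P.
Proof.
  induction b as [|k b IH]; intros P; [apply Cmod_ge_0|].
  apply rsum_nonneg. intros j. apply Rmult_le_pos; [apply pow_le; lra|apply IH].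
Qed.

Lemma snorm_add b : forall P Q, snorm rho b (P + Q)%ser <= snorm rho b P + snorm rho b Q.
Proof.
  induction b as [|k b IH]; intros P Q; [apply Cmod_triangle|].
  rewrite !snorm_cons, <- rsum_add. apply rsum_le. intros j Hj.
  rewrite <- Rmult_plus_distr_l. apply Rmult_le_compat_l; [apply pow_le; lra|apply IH].
Qed.

Lemma snorm_sc b : forall c, snorm rho b (sc c) = Cmod c.
Proof.
  induction b as [|k b IH]; intros c; [reflexivity|].
  rewrite snorm_cons, rsum_first. change (slice (sc c) 0) with (sc c). rewrite IH.
  assert (H : forall m, rsum (fun i => rho ^ S i * snorm rho b (slice (sc c) (S i))) m = 0).
  { induction m as [|m IHm]; [reflexivity|]. cbn [rsum]. rewrite IHm.
    replace (slice (sc c) (S m)) with (sc 0%C)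
      by (extensionality g; rewrite sc_0_at; reflexivity).
    rewrite IH, Cmod_0. ring. }
  rewrite H. ring.
Qed.

Lemma snorm_csum b (F : nat -> ser) m :
  snorm rho b (fun g => csum (fun i => F i g) m) <= rsum (fun i => snorm rho b (F i)) m.
Proof.
  induction m as [|m IH]; cbn [rsum csum].
  - replace (fun g : list nat => RtoC 0) with (sc 0%C)
      by (extensionality g; apply sc_0_at).
    rewrite snorm_sc, Cmod_0. lra.
  - eapply Rle_trans; [apply (snorm_add b (fun g => csum (fun i => F i g) m) (F m))|]. lra.
Qed.

Lemma snorm_mul b : forall P Q, snorm rho b (P * Q)%ser <= snorm rho b P * snorm rho b Q.
Proof.
  induction b as [|k b IH]; intros P Q.
  - simpl. unfold smul. simpl. rewrite Cmod_mult. lra.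
  - rewrite !snorm_cons.
    eapply Rle_trans; [|apply (rsum_convolution_le
      (fun i => rho ^ i * snorm rho b (slice P i))
      (fun i => rho ^ i * snorm rho b (slice Q i)))];
      try (intros i; apply Rmult_le_pos; [apply pow_le; lra|apply snorm_nonneg]).
    apply rsum_le. intros j Hj.
    change (slice (P * Q)%ser j) with
      (fun g => csum (fun i => (slice P i * slice Q (j - i))%ser g) (S j)).
    eapply Rle_trans; [apply Rmult_le_compat_l;
      [apply pow_le; lra|apply (snorm_csum b (fun i => (slice P i * slice Q (j - i))%ser))]|].
    rewrite <- rsum_scal. apply rsum_le. intros i Hi.
    replace (rho ^ j) with (rho ^ i * rho ^ (j - i))
      by (rewrite <- pow_add; f_equal; lia).
    apply Rle_trans with (rho ^ i * rho ^ (j - i) *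
       (snorm rho b (slice P i) * snorm rho b (slice Q (j - i)))).
    + apply Rmult_le_compat_l; [apply Rmult_le_pos; apply pow_le; lra|apply IH].
    + right. ring.
Qed.

Lemma snorm_sopp b P : snorm rho b (sopp P) <= snorm rho b P.
Proof.
  replace (sopp P) with (sc (- (1))%C * P)%ser.
  - eapply Rle_trans; [apply snorm_mul|]. rewrite snorm_sc, Cmod_m1. lra.
  - extensionality g. unfold smul, sopp. rewrite smul_at_sc. ring.
Qed.

Lemma snorm_sub b P Q : snorm rho b (P - Q)%ser <= snorm rho b P + snorm rho b Q.
Proof.
  eapply Rle_trans; [apply snorm_add|]. pose proof (snorm_sopp b Q). lra.
Qed.

Lemma snorm_spow b P k : snorm rho b (spow P k) <= snorm rho b P ^ k.
Proof.
  induction k as [|k IH]; simpl; [rewrite snorm_sc, Cmod_1; lra|].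
  eapply Rle_trans; [apply snorm_mul|]. apply Rmult_le_compat_l; auto. apply snorm_nonneg.
Qed.

Lemma snorm_lift k b P : snorm rho (k :: b) (lift P) = snorm rho b P.
Proof.
  rewrite snorm_cons, rsum_first. change (slice (lift P) 0) with P.
  assert (H : forall m, rsum (fun i => rho ^ S i * snorm rho b (slice (lift P) (S i))) m = 0).
  { induction m as [|m IHm]; [reflexivity|]. cbn [rsum]. rewrite IHm.
    replace (slice (lift P) (S m)) with (sc 0%C)
      by (extensionality g; rewrite sc_0_at; reflexivity).
    rewrite snorm_sc, Cmod_0. ring. }
  rewrite H. ring.
Qed.

Lemma snorm_sX k b : snorm rho (k :: b) sX <= rho.
Proof.
  rewrite snorm_cons.
  assert (H : forall i, rho ^ i * snorm rho b (slice sX i) = if Nat.eqb i 1 then rho else 0).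
  { intros i. destruct (Nat.eqb_spec i 1) as [->|Hi].
    - change (slice sX 1) with (sc 1%C). rewrite snorm_sc, Cmod_1. ring.
    - replace (slice sX i) with (sc 0%C).
      + rewrite snorm_sc, Cmod_0. ring.
      + extensionality g. rewrite sc_0_at. unfold slice, sX.
        apply Nat.eqb_neq in Hi. rewrite Hi. reflexivity. }
  assert (H2 : forall m, rsum (fun i => rho ^ i * snorm rho b (slice sX i)) m =
                         if Nat.leb m 1 then 0 else rho).
  { induction m as [|m IHm]; [reflexivity|]. cbn [rsum]. rewrite IHm, H.
    destruct m as [|[|m]]; simpl; ring. }
  rewrite H2. destruct (Nat.leb _ _); lra.
Qed.

(** The Cauchy estimate, by which norm bounds become coefficient bounds. *)
Lemma coef_le_snorm b : forall P, Cmod (P b) * rho ^ mdeg b <= snorm rho b P.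
Proof.
  induction b as [|k b IH]; intros P; [simpl; lra|].
  rewrite snorm_cons. cbn [rsum].
  assert (0 <= rsum (fun j => rho ^ j * snorm rho b (slice P j)) k).
  { apply rsum_nonneg. intros. apply Rmult_le_pos; [apply pow_le; lra|apply snorm_nonneg]. }
  change (mdeg (k :: b)) with (k + mdeg b)%nat. rewrite pow_add.
  specialize (IH (slice P k)). unfold slice in IH at 1.
  assert (0 < rho ^ k) by (apply pow_lt; lra). nra.
Qed.

(** Each variable contributes a geometric sum of ratio at most 1/2, hence a factor 2. The bound
    depends on the number of variables but not on the size of the box. *)
Lemma snorm_geometric b : forall P A M, 0 <= A -> 0 <= M -> rho * M <= / 2 ->
  (forall g, Forall2 le g b -> Cmod (P g) <= A * M ^ mdeg g) ->
  snorm rho b P <= A * 2 ^ length b.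
Proof.
  induction b as [|k b IH]; intros P A M HA HM HrM H.
  - simpl. specialize (H [] (Forall2_nil _)). simpl in H. lra.
  - rewrite snorm_cons.
    apply Rle_trans with (rsum (fun j => (A * 2 ^ length b) * (/ 2) ^ j) (S k)).
    + apply rsum_le. intros j Hj.
      assert (Hs : snorm rho b (slice P j) <= A * M ^ j * 2 ^ length b).
      { apply (IH _ _ M); auto.
        - apply Rmult_le_pos; auto. apply pow_le; lra.
        - intros g Hg. rewrite Rmult_assoc, <- pow_add.
          apply (H (j :: g)). constructor; auto. lia. }
      apply Rle_trans with (rho ^ j * (A * M ^ j * 2 ^ length b)).
      * apply Rmult_le_compat_l; auto. apply pow_le; lra.
      * replace (rho ^ j * (A * M ^ j * 2 ^ length b))
          with (A * 2 ^ length b * (rho * M) ^ j) by (rewrite Rpow_mult_distr; ring).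
        apply Rmult_le_compat_l; [apply Rmult_le_pos; auto; apply pow_le; lra|].
        apply pow_incr. split; auto. apply Rmult_le_pos; lra.
    + rewrite rsum_scal. simpl length.
      replace (A * 2 ^ S (length b)) with (A * 2 ^ length b * 2) by (simpl; ring).
      apply Rmult_le_compat_l; [apply Rmult_le_pos; auto; apply pow_le; lra|].
      assert (Hg : forall m, rsum (fun j => (/ 2) ^ j) m = 2 - 2 * (/ 2) ^ m).
      { induction m as [|m IHm]; [simpl; lra|]. cbn [rsum]. rewrite IHm. simpl. lra. }
      rewrite Hg. assert (0 < (/ 2) ^ S k) by (apply pow_lt; lra). lra.
Qed.

End Norm.

Lemma mdeg_repeat_0 n : mdeg (repeat 0%nat n) = 0%nat.
Proof. induction n as [|n IH]; [reflexivity|]. exact IH. Qed.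

Lemma mzero_repeat n a : length a = n -> mzero a -> a = repeat 0%nat n.
Proof.
  intros <- H. induction H as [|k a Hk _ IH]; [reflexivity|]. simpl. congruence.
Qed.

Lemma mdeg_pos a : ~ mzero a -> (1 <= mdeg a)%nat.
Proof.
  intros H. destruct (mdeg a) eqn:E; [|lia]. exfalso. apply H. unfold mzero.
  induction a as [|k a IH]; [constructor|]. change (mdeg (k :: a)) with (k + mdeg a)%nat in E.
  constructor; [lia|]. apply IH; [|lia]. intros Ha. apply H. constructor; auto. lia.
Qed.

(** * Reading the substitution inside the ring *)

(** Makes [t] the leading variable. The value at [[]] is chosen so that [U] is multiplicative on all
    lists. *)
Definition U (P : ser2) : ser := fun l =>
  match l with [] => P 0%nat [] | m :: a => P m a end.

Lemma sumC_app l l' : sumC (l ++ l') = (sumC l + sumC l')%C.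
Proof.
  induction l as [|x l IH]; simpl.
  - symmetry. apply Cplus_0_l.
  - rewrite IH. apply Cplus_assoc.
Qed.

Lemma sumC_seq {A} (F : nat -> list A) (G : A -> C) m :
  sumC (map G (flat_map F (seq 0 m))) = csum (fun j => sumC (map G (F j))) m.
Proof.
  induction m as [|m IH]; [reflexivity|].
  rewrite seq_S, flat_map_app, map_app, sumC_app, IH. simpl.
  rewrite app_nil_r. reflexivity.
Qed.

Lemma sumC_map_seq (G : nat -> C) m : sumC (map G (seq 0 m)) = csum G m.
Proof.
  induction m as [|m IH]; [reflexivity|].
  rewrite seq_S, map_app, sumC_app, IH. simpl.
  apply (f_equal (Cplus (csum G m))), Cplus_0_r.
Qed.

Lemma smul_mle_list b : forall P Q : ser,
  sumC (map (fun g => Cmul (P g) (Q (msub b g))) (mle_list b)) = (P * Q)%ser b.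
Proof.
  induction b as [|k b IH]; intros P Q.
  - change (P [] * Q [] + 0 = P [] * Q [])%C. ring.
  - change (mle_list (k :: b)) with
      (flat_map (fun g => map (fun gs => g :: gs) (mle_list b)) (seq 0 (S k))).
    rewrite (sumC_seq (fun g => map (fun gs => g :: gs) (mle_list b))).
    apply csum_ext. intros j Hj. rewrite map_map.
    apply (IH (slice P j) (slice Q (k - j))).
Qed.

Lemma U_mul P Q : U (ser_mul P Q) = (U P * U Q)%ser.
Proof.
  assert (H : forall m a, ser_mul P Q m a = (U P * U Q)%ser (m :: a)).
  { intros m a. unfold ser_mul.
    pose proof (sumC_seq (fun j => map (fun g => Cmul (P j g) (Q (m - j)%nat (msub a g)))
                       (mle_list a)) (fun x => x) (S m)) as E.
    rewrite map_id in E. rewrite E. apply csum_ext. intros j Hj. rewrite map_id.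
    apply (smul_mle_list a (slice (U P) j) (slice (U Q) (m - j))). }
  extensionality l. destruct l as [|m a]; [|apply H]. simpl. rewrite H.
  change (0 + smul_at [] (slice (U P) 0) (slice (U Q) 0) = U P [] * U Q [])%C.
  simpl. unfold slice. simpl. ring.
Qed.

Lemma U_one : U ser_one = sc 1%C.
Proof.
  extensionality l. destruct l as [|[|m] a]; reflexivity.
Qed.

Lemma U_pow P k : U (ser_pow P k) = spow (U P) k.
Proof.
  induction k as [|k IH]; simpl; [apply U_one|]. rewrite U_mul, IH. reflexivity.
Qed.

Lemma ser_subst_csum f P m a :
  ser_subst f P m a = csum (fun k => (U (f k) * spow (U P) k)%ser (m :: a)) (S m).
Proof.
  unfold ser_subst. rewrite sumC_map_seq. apply csum_ext. intros k Hk.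
  rewrite <- U_pow, <- U_mul. reflexivity.
Qed.

Lemma smul_spow_vanish (P Q : ser) k m a :
  (m < k)%nat -> (Q * spow (sX * P) k)%ser (m :: a) = 0%C.
Proof.
  intros H. rewrite spow_mul.
  replace (Q * (spow sX k * spow P k))%ser with (spow sX k * (Q * spow P k))%ser by ring.
  rewrite spow_sX_mul_cons. destruct (Nat.leb_spec k m); [lia|reflexivity].
Qed.

(* The substituted series is divisible by [t]: [phi_z = t (psi + z b_1)]. *)
Definition phi_tail (b : nat -> list nat -> C) : ser := fun l =>
  match l with [] => 0%C | O :: _ => 0%C | S m :: a => b (S (S m)) a end.

Definition phi_quot (b : nat -> list nat -> C) (z : C) : ser :=
  (phi_tail b + lift (b 1%nat) * sc z)%ser.

Lemma U_phi_s b z : U (phi_s b z) = (sX * phi_quot b z)%ser.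
Proof.
  extensionality l. destruct l as [|m a]; [rewrite smul_sX_nil; reflexivity|].
  rewrite smul_sX_cons. destruct m as [|m]; [reflexivity|].
  unfold phi_quot, sadd.
  replace (lift (b 1%nat) * sc z)%ser with (sc z * lift (b 1%nat))%ser by ring.
  unfold smul. rewrite smul_at_sc. simpl.
  destruct m as [|m]; simpl.
  - symmetry. apply Cplus_0_l.
  - rewrite Cmult_0_r. symmetry. apply Cplus_0_r.
Qed.

(** * Products of distances *)

(** The modulus at [z] of the monic polynomial whose roots, with multiplicity, are listed in [l].
    Polynomials in [s] are handled through their root lists. *)
Definition dprod (z : C) (l : list C) : R := fold_right Rmult 1 (map (fun w => Cmod (z - w)) l).

Fixpoint vdm (l : list C) : R :=
  match l with [] => 1 | z :: l' => dprod z l' * vdm l' end.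

Lemma Cmod_sub_sym z w : Cmod (z - w) = Cmod (w - z).
Proof. rewrite <- Cmod_opp. f_equal. ring. Qed.

Lemma dprod_cons z w l : dprod z (w :: l) = Cmod (z - w) * dprod z l.
Proof. reflexivity. Qed.

Lemma dprod_nonneg z l : 0 <= dprod z l.
Proof.
  induction l as [|w l IH]; [compute; lra|]. rewrite dprod_cons.
  apply Rmult_le_pos; auto. apply Cmod_ge_0.
Qed.

Lemma dprod_pos z l : ~ In z l -> 0 < dprod z l.
Proof.
  induction l as [|w l IH]; intros H; [compute; lra|]. rewrite dprod_cons.
  apply Rmult_lt_0_compat; [|apply IH; intros Hin; apply H; now right].
  apply Cmod_gt_0. intros E. apply Ceq_minus in E. apply H. now left.
Qed.

Lemma dprod_In z l : In z l -> dprod z l = 0.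
Proof.
  induction l as [|w l IH]; simpl; [tauto|]. rewrite dprod_cons. intros [->|H].
  - replace (z - z)%C with (RtoC 0) by ring. rewrite Cmod_0. ring.
  - rewrite IH by auto. ring.
Qed.

Lemma dprod_app z l l' : dprod z (l ++ l') = dprod z l * dprod z l'.
Proof.
  induction l as [|w l IH]; simpl; [unfold dprod at 2; simpl; ring|].
  rewrite !dprod_cons, IH. ring.
Qed.

Lemma dprod_perm z l l' : Permutation l l' -> dprod z l = dprod z l'.
Proof.
  induction 1; rewrite ?dprod_cons; try congruence; ring.
Qed.

Lemma vdm_perm l l' : Permutation l l' -> vdm l = vdm l'.
Proof.
  induction 1 as [| x l l' H IH | x y l | l l' l'' H IH H' IH']; simpl; try congruence.
  - rewrite IH, (dprod_perm _ _ _ H). reflexivity.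
  - rewrite !dprod_cons, (Cmod_sub_sym y x). ring.
Qed.

Lemma vdm_nonneg l : 0 <= vdm l.
Proof.
  induction l as [|z l IH]; simpl; [lra|]. apply Rmult_le_pos; auto. apply dprod_nonneg.
Qed.

Lemma vdm_pos_NoDup l : 0 < vdm l -> NoDup l.
Proof.
  induction l as [|z l IH]; intros H; [constructor|]. simpl in H. constructor.
  - intros Hin. rewrite dprod_In in H by auto. lra.
  - apply IH. pose proof (vdm_nonneg l). pose proof (dprod_nonneg z l).
    destruct (Req_dec (vdm l) 0) as [E|E]; [rewrite E in H; lra|lra].
Qed.

Lemma dprod_le_pow z l D : (forall w, In w l -> Cmod (z - w) <= D) -> dprod z l <= D ^ length l.
Proof.
  induction l as [|w l IH]; intros H; [compute; lra|]. rewrite dprod_cons. simpl.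
  apply Rmult_le_compat; auto using dprod_nonneg, Cmod_ge_0.
  - apply H; now left.
  - apply IH; intros; apply H; now right.
Qed.

Lemma dprod_ge_pow z l D :
  0 <= D -> (forall w, In w l -> D <= Cmod (z - w)) -> D ^ length l <= dprod z l.
Proof.
  intros HD. induction l as [|w l IH]; intros H; [compute; lra|]. rewrite dprod_cons. simpl.
  apply Rmult_le_compat; auto using pow_le.
  - apply H; now left.
  - apply IH; intros; apply H; now right.
Qed.

(** Root list of the [k]-th power of a polynomial. *)
Definition list_pow (l : list C) (k : nat) : list C := concat (repeat l k).

Lemma length_list_pow l k : length (list_pow l k) = (k * length l)%nat.
Proof.
  unfold list_pow. induction k as [|k IH]; simpl; [reflexivity|].
  rewrite length_app, IH. reflexivity.
Qed.

Lemma dprod_list_pow z l k : dprod z (list_pow l k) = dprod z l ^ k.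
Proof.
  unfold list_pow. induction k as [|k IH]; simpl; [reflexivity|].
  rewrite dprod_app, IH. reflexivity.
Qed.

Lemma In_list_pow w l k : In w (list_pow l k) -> In w l.
Proof.
  unfold list_pow. induction k as [|k IH]; simpl; [tauto|].
  rewrite in_app_iff. tauto.
Qed.

Lemma vandermonde_abs_vdm (z : nat -> C) m :
  vandermonde_abs z m = vdm (map z (rev (seq 0 m))).
Proof.
  assert (H : forall w k, prodR (fun i => Cnorm (Csub (z i) w)) k
                          = dprod w (map z (rev (seq 0 k)))).
  { intros w k. induction k as [|k IH]; [reflexivity|].
    rewrite seq_S, rev_app_distr. simpl. rewrite IH, dprod_cons.
    change (Cnorm (Csub (z k) w)) with (Cmod (z k - w)).
    rewrite Cmod_sub_sym. ring. }
  unfold vandermonde_abs. induction m as [|m IH]; [reflexivity|].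
  rewrite seq_S, rev_app_distr. simpl. rewrite IH, H. ring.
Qed.

(** * Chebyshev constants and the transfinite diameter *)

Lemma snorm_ssum rho b L c : 0 < rho ->
  (forall P, In P L -> snorm rho b P <= c) -> snorm rho b (ssum L) <= INR (length L) * c.
Proof.
  intros Hr. induction L as [|P L IH]; intros H.
  - simpl ssum. rewrite snorm_sc, Cmod_0 by auto. simpl. lra.
  - simpl ssum. eapply Rle_trans; [apply snorm_add; auto|].
    change (length (P :: L)) with (S (length L)). rewrite S_INR.
    assert (snorm rho b P <= c) by (apply H; now left).
    assert (snorm rho b (ssum L) <= INR (length L) * c) by (apply IH; intros; apply H; now right).
    lra.
Qed.

Lemma list_argmax {A} (t : A -> R) L :
  L <> [] -> exists p, In p L /\ forall q, In q L -> t q <= t p.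
Proof.
  induction L as [|x L IH]; intros H; [congruence|].
  destruct L as [|y L].
  - exists x. split; [now left|]. intros q [->|[]]. lra.
  - destruct IH as [p [Hp Hmax]]; [discriminate|].
    destruct (Rle_dec (t p) (t x)) as [Hle|Hle].
    + exists x. split; [now left|]. intros q [->|Hq]; [lra|]. specialize (Hmax q Hq). lra.
    + exists p. split; [now right|]. intros q [->|Hq]; [lra|auto].
Qed.

Lemma smul_nil P Q : (P * Q)%ser [] = (P [] * Q [])%C.
Proof. reflexivity. Qed.

(* The leading coefficient of the Lagrange interpolant of a monic polynomial is 1, so
   one of its [length Z] terms is at least [1 / length Z]. *)
Lemma exists_small_dprod Z l : NoDup Z -> length Z = S (length l) ->
  exists z r, In (z, r) (sel Z) /\ dprod z r <= INR (length Z) * dprod z l.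
Proof.
  intros Hnd Hlen.
  pose (forms := map (fun w => (sopp (sc w), sc 1%C)) l).
  (* Evaluation at infinity: with [kappa = 1] and [mu = 0] every node ratio becomes [1 / (z - w)]
     and the interpolant becomes the leading coefficient. All series here are constants, so their
     moduli are read at [[]]. *)
  pose proof (interp_forms (sc 1%C) (sc 0%C) forms Z Hnd) as HI.
  unfold forms in HI at 1. rewrite length_map in HI. specialize (HI Hlen).
  assert (H1 : sprod (map (fun p => (fst p * sc 0%C + snd p * sc 1%C)%ser) forms) = sc 1%C).
  { unfold forms. clear. induction l as [|w l IH]; simpl; [reflexivity|]. rewrite IH. ring. }
  rewrite H1 in HI. unfold interp in HI.
  set (F := fun p : C * list C => (sprod (map (form_at (fst p)) forms) *
           sprod (map (node_ratio (sc 1%C) (sc 0%C) (fst p)) (snd p)))%ser) in HI.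
  change (ssum (map F (sel Z)) = sc 1%C) in HI.
  destruct (list_argmax (fun p => Cmod (F p [])) (sel Z)) as [[z r] [Hin Hmax]].
  { intros E. apply (f_equal (@length _)) in E. rewrite length_sel in E. simpl in E. lia. }
  exists z, r. split; auto.
  assert (Hge : 1 <= INR (length Z) * Cmod (F (z, r) [])).
  { rewrite <- Cmod_1 at 1. change (Cmod 1) with (Cmod (sc 1%C [])). rewrite <- HI.
    rewrite <- length_sel, <- (length_map F (sel Z)).
    apply (snorm_ssum 1 [] (map F (sel Z))); [lra|].
    intros P HP. apply in_map_iff in HP as [q [<- Hq]]. apply (Hmax q Hq). }
  assert (Hnd' : NoDup (z :: r)) by (eapply Permutation_NoDup; [apply (sel_perm _ _ _ Hin)|auto]).
  assert (Hz : ~ In z r) by now inversion Hnd'.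
  assert (Hpos := dprod_pos z r Hz).
  assert (E1 : Cmod (sprod (map (form_at z) forms) []) = dprod z l).
  { unfold forms. clear. induction l as [|w l IH]; [apply Cmod_1|].
    rewrite !map_cons, sprod_cons, smul_nil, Cmod_mult, IH, dprod_cons. f_equal. f_equal.
    unfold form_at, sadd, sopp, smul, sc. simpl. ring. }
  assert (E2 : Cmod (sprod (map (node_ratio (sc 1%C) (sc 0%C) z) r) []) = / dprod z r).
  { clear - Hz. induction r as [|w r IH]; [simpl; unfold sc, dprod; simpl; rewrite Cmod_1; field|].
    assert (Hw : (z - w <> 0)%C)
      by (intros E; apply Ceq_minus in E; apply Hz; left; auto).
    assert (Hzr : ~ In z r) by (intros H; apply Hz; now right).
    rewrite !map_cons, sprod_cons, smul_nil, Cmod_mult, IH, dprod_cons, Rinv_mult by auto.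
    f_equal. unfold node_ratio, node_form.
    unfold ssub, sadd, sopp, smul, sc. simpl.
    rewrite <- Cmod_inv by auto. f_equal. ring. }
  unfold F in Hge. simpl fst in Hge. simpl snd in Hge.
  rewrite smul_nil, Cmod_mult, E1, E2 in Hge.
  apply (Rmult_le_compat_r (dprod z r)) in Hge; [|lra].
  replace (INR (length Z) * (dprod z l * / dprod z r) * dprod z r)
    with (INR (length Z) * dprod z l) in Hge by (field; lra). lra.
Qed.

Lemma prodR_nonneg f m : (forall i, 0 <= f i) -> 0 <= prodR f m.
Proof. intros H. induction m; simpl; [lra|]. apply Rmult_le_pos; auto. Qed.

(** Among [k + 1] distinct points, [exists_small_dprod] finds one whose distances to the others have
    product at most [(k + 1) M k]; it is split off and the rest is treated by induction. Repeated
    points make the Vandermonde product vanish. *)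
Lemma vdm_le_prod (K : C -> Prop) (q : nat -> list C) (M : nat -> R) :
  (forall k, length (q k) = k) -> (forall k, 0 <= M k) ->
  (forall k z, K z -> dprod z (q k) <= M k) ->
  forall Z, (forall z, In z Z -> K z) ->
  vdm Z <= prodR (fun k => INR (S k) * M k) (length Z).
Proof.
  intros Hq HM Hb Z. remember (length Z) as m eqn:Hm. symmetry in Hm.
  assert (Hnn : forall i, 0 <= INR (S i) * M i)
    by (intros; apply Rmult_le_pos; auto; apply pos_INR).
  revert Z Hm. induction m as [|m IH]; intros Z Hm HZ.
  - destruct Z; [simpl; lra|discriminate].
  - destruct (classic (NoDup Z)) as [Hnd|Hnd].
    + destruct (exists_small_dprod Z (q m) Hnd) as [z [r [Hin Hle]]]; [rewrite Hq; auto|].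
      pose proof (sel_perm _ _ _ Hin) as HP. rewrite (vdm_perm _ _ HP). simpl.
      assert (Hr : length r = m) by (apply Permutation_length in HP; simpl in HP; lia).
      assert (HK : forall w, In w (z :: r) -> K w)
        by (intros w Hw; apply HZ; eapply Permutation_in; [symmetry; apply HP|auto]).
      rewrite Rmult_comm. apply Rmult_le_compat; auto using dprod_nonneg, vdm_nonneg.
      * apply IH; auto. intros; apply HK; now right.
      * rewrite Hm in Hle. eapply Rle_trans; [apply Hle|].
        change (match m with 0%nat => 1 | S _ => INR m + 1 end) with (INR (S m)).
        apply Rmult_le_compat_l; [apply pos_INR|]. apply Hb, HK. now left.
    + apply Rle_trans with 0; [|apply prodR_nonneg; auto].
      destruct (Rle_dec (vdm Z) 0); auto. exfalso. apply Hnd, vdm_pos_NoDup. lra.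
Qed.

(** Chebyshev constant zero, with roots in the disc of radius [r]. The restriction on the roots
    gives every such polynomial a trivial bound on that disc, which is used when polynomials for
    several sets are multiplied. *)
Definition cheb_zero (r : R) (K : C -> Prop) : Prop :=
  forall eps, 0 < eps -> exists l, l <> [] /\ (forall w, In w l -> Cmod w <= r) /\
    forall z, K z -> dprod z l <= eps ^ length l.

Lemma pow_le_anti x i j : 0 <= x <= 1 -> (i <= j)%nat -> x ^ j <= x ^ i.
Proof.
  intros Hx Hij. replace j with (i + (j - i))%nat by lia. rewrite pow_add.
  rewrite <- (Rmult_1_r (x ^ i)) at 2. apply Rmult_le_compat_l; [apply pow_le; lra|].
  rewrite <- (pow1 (j - i)). apply pow_incr. lra.
Qed.

Lemma transfinite_diameter_zero_le (K : C -> Prop) :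
  (forall eps, 0 < eps < 1 -> exists N : nat, forall m : nat, (2 <= m)%nat -> (N <= m)%nat ->
    forall z : nat -> C, (forall i, (i < m)%nat -> K (z i)) ->
      vandermonde_abs z m <= eps ^ (m * (m - 1) / 2)) ->
  transfinite_diameter_zero K.
Proof.
  intros H eps Heps. destruct (H (Rmin eps (/ 2))) as [N HN].
  { split; [apply Rmin_glb_lt; lra|]. eapply Rle_lt_trans; [apply Rmin_r|lra]. }
  exists N. intros m H2 Hm z Hz. eapply Rle_trans; [apply HN; auto|].
  apply pow_incr. split; [apply Rmin_glb; lra|apply Rmin_l].
Qed.

Lemma INR_S_le_pow2 k : INR (S k) <= 2 ^ k.
Proof.
  induction k as [|k IH]; [simpl; lra|]. rewrite S_INR. rewrite S_INR in *.
  pose proof (pos_INR k). simpl. lra.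
Qed.

Lemma cheb_zero_transfinite_diameter r K :
  (forall z, K z -> Cmod z <= r) -> cheb_zero r K -> transfinite_diameter_zero K.
Proof.
  intros HK Hc. apply transfinite_diameter_zero_le. intros eps Heps.
  (* The 2 absorbs the factors [k + 1 <= 2^k]. The square gives the product over [k < m] twice the
     required exponent, and the surplus absorbs a constant to the power [m]. *)
  pose (e1 := eps ^ 2 / 2).
  assert (He1 : 0 < e1 <= 1) by (unfold e1; simpl; nra).
  destruct (Hc e1) as [l [Hl [_ Hdl]]]; [lra|].
  pose (d := length l).
  assert (Hd : (0 < d)%nat) by (unfold d; destruct l; simpl; [congruence|lia]).
  pose (B := Rmax r 1).
  assert (HB : 1 <= B) by apply Rmax_r.
  (* A monic polynomial in every degree: a power of the given one, filled up with roots at 0. The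
     constant [A] pays for the incomplete block of fewer than [d] roots. *)
  pose (q := fun k => list_pow l (k / d) ++ repeat (RtoC 0) (k mod d)).
  pose (A := B ^ d * / e1 ^ d).
  pose (M := fun k => A * e1 ^ k).
  assert (HBd : 1 <= B ^ d) by (rewrite <- (pow1 d); apply pow_incr; lra).
  assert (Hed : 0 < e1 ^ d <= 1).
  { split; [apply pow_lt; lra|]. rewrite <- (pow1 d). apply pow_incr. lra. }
  assert (HA : 1 <= A).
  { unfold A. rewrite <- (Rmult_1_l 1) at 1. apply Rmult_le_compat; try lra.
    rewrite <- Rinv_1 at 1. apply Rinv_le_contravar; lra. }
  assert (Hq : forall k z, K z -> dprod z (q k) <= M k).
  { intros k z Hz. unfold q. rewrite dprod_app, dprod_list_pow.
    assert (Hmod := Nat.mod_upper_bound k d ltac:(lia)).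
    assert (Hdiv := Nat.div_mod_eq k d).
    apply Rle_trans with ((e1 ^ d) ^ (k / d) * B ^ d).
    - apply Rmult_le_compat; auto using dprod_nonneg, pow_le.
      + apply pow_incr. split; [apply dprod_nonneg|]. apply Hdl; auto.
      + eapply Rle_trans; [apply (dprod_le_pow _ _ B)|].
        * intros w Hw. apply repeat_spec in Hw. subst w.
          replace (z - 0)%C with z by ring. eapply Rle_trans; [apply HK; auto|apply Rmax_l].
        * rewrite repeat_length. apply Rle_pow; auto. lia.
    - unfold M, A. rewrite <- pow_mult.
      replace (B ^ d * / e1 ^ d * e1 ^ k) with ((e1 ^ k * / e1 ^ d) * B ^ d) by ring.
      apply Rmult_le_compat_r; [lra|].
      apply (Rmult_le_reg_r (e1 ^ d)); [lra|].
      replace (e1 ^ k * / e1 ^ d * e1 ^ d) with (e1 ^ k) by (field; lra).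
      rewrite <- pow_add. apply pow_le_anti; [lra|]. nia. }
  assert (HM : forall k, INR (S k) * M k <= A * (eps ^ 2) ^ k).
  { intros k. unfold M.
    replace (eps ^ 2) with (2 * e1) by (unfold e1; field).
    rewrite Rpow_mult_distr. pose proof (INR_S_le_pow2 k).
    assert (0 <= A * e1 ^ k) by (apply Rmult_le_pos; [lra|apply pow_le; lra]). nra. }
  assert (Hprod : forall m, prodR (fun k => INR (S k) * M k) m <= A ^ m * eps ^ (m * (m - 1))).
  { induction m as [|m IH]; [simpl; lra|]. cbn [prodR].
    apply Rle_trans with ((A ^ m * eps ^ (m * (m - 1))) * (A * (eps ^ 2) ^ m)).
    - apply Rmult_le_compat; auto.
      + apply prodR_nonneg. intros. apply Rmult_le_pos; [apply pos_INR|].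
        apply Rmult_le_pos; [lra|apply pow_le; lra].
      + apply Rmult_le_pos; [apply pos_INR|].
        apply Rmult_le_pos; [lra|apply pow_le; lra].
    - rewrite <- pow_mult. replace (S m * (S m - 1))%nat with (m * (m - 1) + 2 * m)%nat by nia.
      rewrite pow_add. simpl. lra. }
  (* With [A eps^p < 1] and [m > 2p], the surplus [eps^(m(m-1)/2)] is at most [eps^(pm)] and so
     outweighs [A^m]. *)
  destruct (pow_lt_1_zero eps ltac:(rewrite Rabs_pos_eq; lra) (/ A)
              ltac:(apply Rinv_0_lt_compat; lra)) as [p Hp].
  specialize (Hp p (le_n _)). rewrite Rabs_pos_eq in Hp by (apply pow_le; lra).
  exists (2 * p + 1)%nat. intros m Hm2 Hm z Hz.
  rewrite vandermonde_abs_vdm.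
  eapply Rle_trans; [apply (vdm_le_prod K q M)|].
  - intros k. unfold q. rewrite length_app, length_list_pow, repeat_length.
    pose proof (Nat.div_mod_eq k d). fold d. lia.
  - intros k. unfold M. apply Rmult_le_pos; [lra|apply pow_le; lra].
  - exact Hq.
  - intros w Hw. apply in_map_iff in Hw as [i [<- Hi]]. apply in_rev, in_seq in Hi.
    apply Hz. lia.
  - rewrite length_map, length_rev, length_seq.
    eapply Rle_trans; [apply Hprod|].
    set (T := (m * (m - 1) / 2)%nat).
    assert (HT : (m * (m - 1) = T + T)%nat).
    { assert (Hev : Nat.even (m * (m - 1)) = true).
      { rewrite Nat.even_mul. destruct m as [|m]; [reflexivity|].
        replace (S m - 1)%nat with m by lia. rewrite Nat.even_succ, <- Nat.negb_even.
        destruct (Nat.even m); reflexivity. }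
      apply Nat.even_spec in Hev as [c Hc2]. unfold T. rewrite Hc2.
      rewrite (Nat.mul_comm 2 c), Nat.div_mul by lia. lia. }
    rewrite HT, pow_add, <- Rmult_assoc.
    rewrite <- (Rmult_1_l (eps ^ T)) at 3. apply Rmult_le_compat_r; [apply pow_le; lra|].
    apply Rle_trans with (A ^ m * eps ^ (p * m)).
    + apply Rmult_le_compat_l; [apply pow_le; lra|]. apply pow_le_anti; [lra|]. nia.
    + rewrite pow_mult, <- Rpow_mult_distr, <- (pow1 m). apply pow_incr.
      split; [apply Rmult_le_pos; [lra|apply pow_le; lra]|].
      apply (Rmult_lt_compat_l A) in Hp; [|lra]. rewrite Rinv_r in Hp by lra. lra.
Qed.

Lemma pow_lt_mono x y k : 0 <= x < y -> (0 < k)%nat -> x ^ k < y ^ k.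
Proof.
  intros Hxy Hk. destruct k as [|k]; [lia|]. simpl.
  apply Rle_lt_trans with (x * y ^ k).
  - apply Rmult_le_compat_l; [lra|]. apply pow_incr. lra.
  - apply Rmult_lt_compat_r; [apply pow_lt; lra|lra].
Qed.

(** Otherwise each nonempty list of roots in [K] leaves a point of [K] where the polynomial exceeds
    [eps^degree]. Adding such points greedily, starting from [z0], keeps the Vandermonde product of
    [m] points at least [eps^(m(m-1)/2)], which contradicts diameter zero at [eps / 2]. *)
Lemma transfinite_diameter_zero_cheb (K : C -> Prop) z0 eps :
  transfinite_diameter_zero K -> K z0 -> 0 < eps ->
  exists l, l <> [] /\ (forall w, In w l -> K w) /\
    forall z, K z -> dprod z l <= eps ^ length l.
Proof.
  intros HT Hz0 Heps. apply NNPP. intros Hno.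
  assert (Hex : forall l, exists z, l <> [] -> (forall w, In w l -> K w) ->
                  K z /\ eps ^ length l < dprod z l).
  { intros l. apply NNPP. intros H. apply Hno. exists l.
    assert (Hl : l <> []) by (intros E; apply H; exists z0; congruence).
    split; auto. split.
    - intros w Hw. apply NNPP. intros HKw. apply H. exists z0. intros _ Hall.
      exfalso. apply HKw. auto.
    - intros z Hz. apply Rnot_lt_le. intros Hlt. apply H. exists z. auto. }
  apply choice in Hex as [nxt Hnxt].
  pose (L := fix L m := match m with O => [z0] | S m' => nxt (L m') :: L m' end).
  assert (HL : forall m, L m <> [] /\ length (L m) = S m /\ (forall w, In w (L m) -> K w) /\
                eps ^ (S m * m / 2) <= vdm (L m)).
  { induction m as [|m [Hne [Hlen [HK Hv]]]].
    - simpl. repeat split; auto; try discriminate; [intuition; now subst|].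
      unfold dprod; simpl; lra.
    - destruct (Hnxt (L m) Hne HK) as [Hk Hlt]. simpl L.
      split; [discriminate|]. split; [simpl; lia|]. split.
      + intros w [<-|Hw]; auto.
      + replace (S (S m) * S m / 2)%nat with (S m + S m * m / 2)%nat.
        * rewrite pow_add. rewrite Hlen in Hlt. cbn [vdm].
          apply Rmult_le_compat; try (apply pow_le; lra); lra.
        * replace (S (S m) * S m)%nat with (S m * m + S m * 2)%nat by lia.
          rewrite Nat.div_add by lia. lia. }
  (* The head of [L i] is the point added last, so all lists [L m] are reversed initial segments of
     one sequence. The default is never reached, as [L i] is nonempty. *)
  pose (z := fun i => hd z0 (L i)).
  assert (Hz : forall m, map z (rev (seq 0 (S m))) = L m).
  { induction m as [|m IH]; [reflexivity|].
    rewrite seq_S, rev_app_distr, map_app. rewrite IH. reflexivity. }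
  destruct (HT (eps / 2)) as [N HN]; [lra|].
  specialize (HN (S (S N)) ltac:(lia) ltac:(lia) z).
  rewrite vandermonde_abs_vdm, Hz in HN.
  destruct (HL (S N)) as [_ [_ [_ Hv]]].
  assert (HK : forall i, (i < S (S N))%nat -> K (z i)).
  { intros i _. destruct (HL i) as [Hne [_ [HK _]]]. apply HK. unfold z.
    destruct (L i); [congruence|now left]. }
  specialize (HN HK).
  replace (S (S N) - 1)%nat with (S N) in HN by lia.
  replace (S (S N) * S N / 2)%nat with (S (N + S N * N / 2)) in *.
  - set (t := (N + S N * N / 2)%nat) in *.
    assert ((eps / 2) ^ S t < eps ^ S t) by (apply pow_lt_mono; lia || lra).
    lra.
  - replace (S (S N) * S N)%nat with (S N * N + S N * 2)%nat by lia.
    rewrite Nat.div_add by lia. lia.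
Qed.

(** * Continuity and compactness in the plane *)

Definition contC (g : C -> C) : Prop :=
  forall z eps, 0 < eps -> exists del, 0 < del /\
    forall w, Cmod (w - z) < del -> Cmod (g w - g z) < eps.

Lemma contC_const c : contC (fun _ => c).
Proof.
  intros z eps H. exists 1. split; [lra|]. intros w _.
  replace (c - c)%C with (RtoC 0) by ring. rewrite Cmod_0. auto.
Qed.

Lemma contC_id : contC (fun z => z).
Proof. intros z eps H. exists eps. auto. Qed.

Lemma contC_add g h : contC g -> contC h -> contC (fun z => (g z + h z)%C).
Proof.
  intros Hg Hh z eps He.
  destruct (Hg z (eps / 2)) as [d1 [Hd1 H1]]; [lra|].
  destruct (Hh z (eps / 2)) as [d2 [Hd2 H2]]; [lra|].
  exists (Rmin d1 d2). split; [apply Rmin_glb_lt; auto|]. intros w Hw.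
  specialize (H1 w (Rlt_le_trans _ _ _ Hw (Rmin_l _ _))).
  specialize (H2 w (Rlt_le_trans _ _ _ Hw (Rmin_r _ _))).
  replace (g w + h w - (g z + h z))%C with ((g w - g z) + (h w - h z))%C by ring.
  eapply Rle_lt_trans; [apply Cmod_triangle|]. lra.
Qed.

Lemma contC_mul g h : contC g -> contC h -> contC (fun z => (g z * h z)%C).
Proof.
  intros Hg Hh z eps He.
  pose (a := Cmod (g z)). pose (c := Cmod (h z)).
  assert (Ha : 0 <= a) by apply Cmod_ge_0. assert (Hc : 0 <= c) by apply Cmod_ge_0.
  destruct (Hg z (eps / 2 / (c + 1))) as [d1 [Hd1 H1]].
  { apply Rdiv_lt_0_compat; lra. }
  destruct (Hh z (Rmin 1 (eps / 2 / (a + 1)))) as [d2 [Hd2 H2]].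
  { apply Rmin_glb_lt; [lra|]. apply Rdiv_lt_0_compat; lra. }
  exists (Rmin d1 d2). split; [apply Rmin_glb_lt; auto|]. intros w Hw.
  specialize (H1 w (Rlt_le_trans _ _ _ Hw (Rmin_l _ _))).
  specialize (H2 w (Rlt_le_trans _ _ _ Hw (Rmin_r _ _))).
  assert (H3 := Rlt_le_trans _ _ _ H2 (Rmin_l _ _)).
  assert (H4 := Rlt_le_trans _ _ _ H2 (Rmin_r _ _)).
  replace (g w * h w - g z * h z)%C with ((g w - g z) * h w + g z * (h w - h z))%C by ring.
  eapply Rle_lt_trans; [apply Cmod_triangle|]. rewrite !Cmod_mult. fold a.
  assert (Hw' : Cmod (h w) <= c + 1).
  { replace (h w) with (h z + (h w - h z))%C by ring.
    eapply Rle_trans; [apply Cmod_triangle|]. fold c. lra. }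
  assert (E1 : eps / 2 / (c + 1) * (c + 1) = eps / 2) by (field; lra).
  assert (E2 : (a + 1) * (eps / 2 / (a + 1)) = eps / 2) by (field; lra).
  assert (Cmod (g w - g z) * Cmod (h w) <= Cmod (g w - g z) * (c + 1))
    by (apply Rmult_le_compat_l; auto using Cmod_ge_0).
  assert (Cmod (g w - g z) * (c + 1) < eps / 2)
    by (rewrite <- E1; apply Rmult_lt_compat_r; lra).
  assert (a * Cmod (h w - h z) <= (a + 1) * (eps / 2 / (a + 1)))
    by (apply Rmult_le_compat; auto using Cmod_ge_0; lra).
  lra.
Qed.

Lemma contC_csum (g : nat -> C -> C) m :
  (forall i, contC (g i)) -> contC (fun z => csum (fun i => g i z) m).
Proof.
  intros H. induction m as [|m IH]; simpl; [apply contC_const|].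
  apply contC_add; auto.
Qed.

Lemma contC_lt g z c : contC g -> Cmod (g z) < c ->
  exists del, 0 < del /\ forall w, Cmod (w - z) < del -> Cmod (g w) < c.
Proof.
  intros Hg Hc. destruct (Hg z (c - Cmod (g z))) as [d [Hd H]]; [lra|].
  exists d. split; auto. intros w Hw. specialize (H w Hw).
  replace (g w) with (g z + (g w - g z))%C by ring.
  eapply Rle_lt_trans; [apply Cmod_triangle|]. lra.
Qed.

Lemma contC_gt g z c : contC g -> c < Cmod (g z) ->
  exists del, 0 < del /\ forall w, Cmod (w - z) < del -> c < Cmod (g w).
Proof.
  intros Hg Hc. destruct (Hg z (Cmod (g z) - c)) as [d [Hd H]]; [lra|].
  exists d. split; auto. intros w Hw. specialize (H w Hw).
  assert (Cmod (g z) <= Cmod (g w) + Cmod (g w - g z)); [|lra].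
  rewrite (Cmod_sub_sym (g w)).
  replace (g z) with (g w + (g z - g w))%C at 1 by ring. apply Cmod_triangle.
Qed.

Definition cprod (z : C) (l : list C) : C := fold_right (fun w p => (z - w) * p)%C (RtoC 1) l.

Lemma Cmod_cprod z l : Cmod (cprod z l) = dprod z l.
Proof.
  unfold cprod, dprod. induction l as [|w m IH]; simpl; [apply Cmod_1|].
  rewrite Cmod_mult, IH. reflexivity.
Qed.

Lemma dprod_lt_open z l c : dprod z l < c ->
  exists del, 0 < del /\ forall w, Cmod (w - z) < del -> dprod w l < c.
Proof.
  assert (Hc : contC (fun z => cprod z l)).
  { unfold cprod. induction l as [|w m IH]; simpl; [apply contC_const|].
    apply contC_mul; auto. unfold Cminus. apply contC_add; [apply contC_id|apply contC_const]. }
  intros H. rewrite <- Cmod_cprod in H. destruct (contC_lt _ _ _ Hc H) as [d [Hd H']].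
  exists d. split; auto. intros w Hw. rewrite <- Cmod_cprod. auto.
Qed.

Lemma ValAdh_interval (u : nat -> R) M : (forall i, Rabs (u i) <= M) ->
  exists l, forall eps N, 0 < eps -> exists p, (N <= p)%nat /\ Rabs (u p - l) < eps.
Proof.
  intros H. destruct (Bolzano_Weierstrass u (fun c => - M <= c <= M) (compact_P3 (- M) M))
    as [l Hl].
  { intros i. specialize (H i). unfold Rabs in H. destruct (Rcase_abs (u i)); lra. }
  exists l. intros eps N He.
  destruct (Hl (disc l (mkposreal eps He)) N) as [p [Hp Hd]].
  { exists (mkposreal eps He). intros x Hx. exact Hx. }
  exists p. split; auto.
Qed.

Lemma bounded_cluster_point (u : nat -> C) M : (forall i, Cmod (u i) <= M) ->
  exists l, forall eps N, 0 < eps -> exists p, (N <= p)%nat /\ Cmod (u p - l) < eps.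
Proof.
  intros HM.
  assert (HM' : forall i, Rabs (fst (u i)) <= M /\ Rabs (snd (u i)) <= M).
  { intros i. specialize (HM i). pose proof (Rmax_Cmod (u i)) as H.
    pose proof (Rmax_l (Rabs (fst (u i))) (Rabs (snd (u i)))).
    pose proof (Rmax_r (Rabs (fst (u i))) (Rabs (snd (u i)))). lra. }
  destruct (ValAdh_interval (fun i => fst (u i)) M) as [l1 H1]; [apply HM'|].
  assert (Hs : forall i, exists p, (i <= p)%nat /\ Rabs (fst (u p) - l1) < / INR (S i)).
  { intros i. apply H1. apply Rinv_0_lt_compat, lt_0_INR. lia. }
  apply choice in Hs as [s Hs].
  destruct (ValAdh_interval (fun i => snd (u (s i))) M) as [l2 H2]; [intros; apply HM'|].
  exists (l1, l2). intros eps N He.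
  destruct (archimed_cor1 (eps / 2)) as [N0 [HN0 HN0']]; [lra|].
  destruct (H2 (eps / 2) (N + N0)%nat) as [i [Hi Hi']]; [lra|].
  destruct (Hs i) as [Hsi Hsi']. exists (s i). split; [lia|].
  assert (Hinv : / INR (S i) <= / INR N0).
  { apply Rinv_le_contravar; [apply lt_0_INR; lia|apply le_INR; lia]. }
  eapply Rle_lt_trans; [apply Cmod_2Rmax|].
  assert (Hm : Rmax (Rabs (fst (u (s i) - (l1, l2))%C)) (Rabs (snd (u (s i) - (l1, l2))%C)) < eps / 2).
  { apply Rmax_lub_lt.
    - change (Rabs (fst (u (s i)) - l1) < eps / 2). lra.
    - exact Hi'. }
  assert (0 <= Rmax (Rabs (fst (u (s i) - (l1, l2))%C)) (Rabs (snd (u (s i) - (l1, l2))%C))).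
  { eapply Rle_trans; [apply Rabs_pos|apply Rmax_l]. }
  assert (0 <= sqrt 2 <= 2).
  { split; [apply sqrt_pos|]. rewrite <- (sqrt_Rsqr 2) at 2 by lra.
    apply sqrt_le_1_alt. unfold Rsqr. lra. }
  nra.
Qed.

(** Points [u m] of [K] outside the first [m] sets would cluster at a point of [K]; the open set
    covering that point would contain [u p] for some [p] beyond its own index. *)
Lemma compact_nat_cover (K : C -> Prop) (O : nat -> C -> Prop) : compactC K ->
  (forall k z, O k z -> exists del, 0 < del /\ forall w, Cmod (w - z) < del -> O k w) ->
  (forall z, K z -> exists k, O k z) ->
  exists m, forall z, K z -> exists k, (k < m)%nat /\ O k z.
Proof.
  intros [Hcl [M HM]] Hop Hcov. apply NNPP. intros Hno.
  assert (Hex : forall m : nat, exists z, K z /\ forall k, (k < m)%nat -> ~ O k z).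
  { intros m. apply NNPP. intros H. apply Hno. exists m. intros z Hz.
    apply NNPP. intros H'. apply H. exists z. split; auto.
    intros k Hk HO. apply H'. exists k. auto. }
  apply choice in Hex as [u Hu].
  destruct (bounded_cluster_point u M) as [l Hl].
  { intros i. apply HM. apply Hu. }
  assert (HKl : K l).
  { apply NNPP. intros H. destruct (Hcl l H) as [d [Hd Hd']].
    destruct (Hl d 0%nat Hd) as [p [_ Hp]]. apply (Hd' (u p) Hp). apply Hu. }
  destruct (Hcov l HKl) as [k Hk]. destruct (Hop k l Hk) as [d [Hd Hd']].
  destruct (Hl d (S k) Hd) as [p [Hp Hp']].
  destruct (Hu p) as [_ Hup]. apply (Hup k ltac:(lia)). auto.
Qed.

(** * Countable unions of sets with zero Chebyshev constant *)

Section Union.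
Variables (r : R) (K : C -> Prop).
Hypothesis r_nonneg : 0 <= r.
Hypothesis K_bounded : forall z, K z -> Cmod z <= r.

Let D := 2 * r + 1.

(** Smallness relative to the trivial bound [D ^ degree], where [D = 2 r + 1] exceeds every distance
    within the disc and is positive even for [r = 0]. *)
Definition cheb_small (O : C -> Prop) (e : R) : Prop :=
  exists l, l <> [] /\ (forall w, In w l -> Cmod w <= r) /\
    forall z, K z -> O z -> dprod z l <= (D * e) ^ length l.

(** Powers bring both polynomials to degree [d1 d2], and their product is used. On either set one
    factor has its small bound and the other the trivial one, so that [e^2] in degree [d1 d2]
    becomes [e] in degree [2 d1 d2]. *)
Lemma cheb_small_union O1 O2 e : 0 < e ->
  cheb_small O1 (e ^ 2) -> cheb_small O2 (e ^ 2) -> cheb_small (fun z => O1 z \/ O2 z) e.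
Proof.
  intros He [l1 [Hn1 [Hr1 H1]]] [l2 [Hn2 [Hr2 H2]]].
  pose (d1 := length l1). pose (d2 := length l2).
  assert (Hd1 : (0 < d1)%nat) by (unfold d1; destruct l1; simpl; [congruence|lia]).
  assert (Hd2 : (0 < d2)%nat) by (unfold d2; destruct l2; simpl; [congruence|lia]).
  assert (HD : 0 < D) by (unfold D; lra).
  assert (Htriv : forall z l, K z -> (forall w, In w l -> Cmod w <= r) -> dprod z l <= D ^ length l).
  { intros z l Hz Hl. apply dprod_le_pow. intros w Hw. specialize (Hl w Hw).
    specialize (K_bounded z Hz). unfold Cminus. eapply Rle_trans; [apply Cmod_triangle|].
    rewrite Cmod_opp. unfold D. lra. }
  exists (list_pow l1 d2 ++ list_pow l2 d1). split; [|split].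
  - intros E. apply (f_equal (@length _)) in E.
    rewrite length_app, !length_list_pow in E. simpl in E. fold d1 d2 in E. nia.
  - intros w Hw. apply in_app_or in Hw as [Hw|Hw]; apply In_list_pow in Hw; auto.
  - intros z Hz HO. rewrite length_app, !length_list_pow, dprod_app, !dprod_list_pow.
    fold d1 d2.
    assert (HE : (D * e) ^ (d2 * d1 + d1 * d2)
                 = ((D * e ^ 2) ^ d1) ^ d2 * (D ^ d2) ^ d1).
    { rewrite <- !pow_mult, !Rpow_mult_distr, <- !pow_mult, !pow_add.
      replace (2 * (d1 * d2))%nat with (d1 * d2 + d1 * d2)%nat by lia.
      rewrite pow_add, (Nat.mul_comm d2 d1). ring. }
    assert (HE' : (D * e) ^ (d2 * d1 + d1 * d2)
                 = (D ^ d1) ^ d2 * ((D * e ^ 2) ^ d2) ^ d1).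
    { rewrite <- !pow_mult, !Rpow_mult_distr, <- !pow_mult, !pow_add.
      replace (2 * (d2 * d1))%nat with (d1 * d2 + d1 * d2)%nat by lia.
      rewrite pow_add, (Nat.mul_comm d2 d1). ring. }
    destruct HO as [HO|HO]; [rewrite HE|rewrite HE'];
      apply Rmult_le_compat; try (apply pow_le, dprod_nonneg);
      apply pow_incr; split; auto using dprod_nonneg; apply Htriv; auto.
Qed.

(** The [k]-th set lies under at most [S k] nested unions, each of which squares [e]. The demand on
    it does not depend on [m], so the polynomials can be chosen before compactness supplies [m]. *)
Lemma cheb_small_finite_union m : forall (O : nat -> C -> Prop) e, 0 < e ->
  (forall k, (k < m)%nat -> cheb_small (O k) (e ^ (2 ^ S k))) ->
  cheb_small (fun z => exists k, (k < m)%nat /\ O k z) e.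
Proof.
  induction m as [|m IH]; intros O e He H.
  - exists [RtoC 0]. split; [discriminate|]. split.
    + intros w [<-|[]]. rewrite Cmod_0. auto.
    + intros z _ [k [Hk _]]. lia.
  - assert (He2 : 0 < e ^ 2) by (apply pow_lt; auto).
    assert (H0 : cheb_small (O 0%nat) (e ^ 2)) by (apply (H 0%nat); lia).
    assert (H1 : cheb_small (fun z => exists k, (k < m)%nat /\ O (S k) z) (e ^ 2)).
    { apply (IH (fun k => O (S k))); auto. intros k Hk. rewrite <- pow_mult.
      replace (2 * 2 ^ S k)%nat with (2 ^ S (S k))%nat by (simpl; lia). apply H. lia. }
    destruct (cheb_small_union _ _ e He H0 H1) as [l [Hl [Hr Hb]]].
    exists l. split; auto. split; auto. intros z Hz [k [Hk HO]]. apply Hb; auto.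
    destruct k as [|k]; [now left|right]. exists k. split; auto. lia.
Qed.

(** Each [Kn k] is enlarged to the open set where its polynomial obeys a strict bound; by
    compactness finitely many of these cover [K]. *)
Lemma cheb_zero_countable_union (Kn : nat -> C -> Prop) : compactC K ->
  (forall z, K z -> exists k, Kn k z) -> (forall k, cheb_zero r (Kn k)) -> cheb_zero r K.
Proof.
  intros Hcomp Hcov Hz eps Heps.
  assert (HD : 0 < D) by (unfold D; lra).
  pose (e := eps / D). assert (He : 0 < e) by (apply Rdiv_lt_0_compat; auto).
  assert (Hek : forall k, 0 < D * e ^ (2 ^ S k))
    by (intros; apply Rmult_lt_0_compat; auto; apply pow_lt; auto).
  assert (Hch : forall k, exists l, l <> [] /\ (forall w, In w l -> Cmod w <= r) /\
            forall z, Kn k z -> dprod z l < (D * e ^ (2 ^ S k)) ^ length l).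
  { intros k. specialize (Hek k).
    (* Halving makes the inequality strict, as openness requires. *)
    destruct (Hz k (D * e ^ (2 ^ S k) / 2)) as [l [Hl [Hr Hb]]]; [lra|].
    exists l. split; auto. split; auto. intros z HK. eapply Rle_lt_trans; [apply Hb; auto|].
    apply pow_lt_mono; [lra|]. destruct l; [congruence|simpl; lia]. }
  apply choice in Hch as [l Hl].
  destruct (compact_nat_cover K (fun k z => dprod z (l k) < (D * e ^ (2 ^ S k)) ^ length (l k)))
    as [m Hm]; auto.
  - intros k z HO. apply dprod_lt_open. auto.
  - intros z HKz. destruct (Hcov z HKz) as [k Hk]. exists k. apply Hl. auto.
  - destruct (cheb_small_finite_union m
      (fun k z => dprod z (l k) < (D * e ^ (2 ^ S k)) ^ length (l k)) e He) as [q [Hq [Hr Hb]]].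
    + intros k _. destruct (Hl k) as [Hn [Hrk _]]. exists (l k).
      split; auto. split; auto. intros; lra.
    + exists q. split; auto. split; auto. intros z HKz.
      replace eps with (D * e) by (unfold e; field; lra). apply Hb; auto.
Qed.

(* Points nearly maximising the Vandermonde product: replacing one of them by another
   point of [K] multiplies the product by at most 2. *)
Lemma exists_fekete_points eta : 0 < eta -> (exists z, K z) ->
  (forall l, l <> [] -> (forall w, In w l -> K w) ->
     exists z, K z /\ eta ^ length l < dprod z l) ->
  forall d, exists Z, length Z = S d /\ (forall z, In z Z -> K z) /\ NoDup Z /\
    forall z q, In (z, q) (sel Z) -> eta ^ d / 2 <= dprod z q.
Proof.
  intros Heta [z0 Hz0] Hbig d.
  pose (S_ := fun v => exists Z, length Z = S d /\ (forall z, In z Z -> K z) /\ v = vdm Z).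
  assert (Hpos : forall m, exists Z, length Z = S m /\ (forall z, In z Z -> K z) /\ 0 < vdm Z).
  { induction m as [|m [Z [Hlen [HZ Hv]]]].
    - exists [z0]. split; [reflexivity|]. split; [intros z [<-|[]]; auto|].
      unfold vdm, dprod. simpl. lra.
    - destruct (Hbig Z) as [z [Hz Hlt]]; auto; [destruct Z; discriminate|].
      exists (z :: Z). split; [simpl; congruence|]. split; [intros w [<-|Hw]; auto|].
      simpl. apply Rmult_lt_0_compat; auto. eapply Rlt_trans; [|apply Hlt]. apply pow_lt; auto. }
  assert (Hbd : forall m, exists B, forall Z, length Z = m -> (forall z, In z Z -> K z) -> vdm Z <= B).
  { induction m as [|m [B HB]].
    - exists 1. intros Z HZ _. destruct Z; [simpl; lra|discriminate].
    - exists (D ^ m * B). intros Z HZ HK. destruct Z as [|z Z]; [discriminate|]. simpl.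
      injection HZ as HZ. apply Rmult_le_compat; auto using dprod_nonneg, vdm_nonneg.
      + rewrite <- HZ. apply dprod_le_pow. intros w Hw. unfold Cminus.
        eapply Rle_trans; [apply Cmod_triangle|]. rewrite Cmod_opp.
        assert (Cmod z <= r) by (apply K_bounded, HK; now left).
        assert (Cmod w <= r) by (apply K_bounded, HK; now right). unfold D. lra.
      + apply HB; auto. intros; apply HK; now right. }
  destruct (Hpos d) as [Z0 [HZ0 [HKZ0 Hv0]]]. destruct (Hbd (S d)) as [B HB].
  destruct (completeness S_) as [L [HLub HLlub]].
  { exists B. intros v [Z [HZ [HK ->]]]. auto. }
  { exists (vdm Z0), Z0. auto. }
  assert (HL : 0 < L).
  { apply Rlt_le_trans with (vdm Z0); auto. apply HLub. exists Z0. auto. }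
  assert (HexZ : exists Z, length Z = S d /\ (forall z, In z Z -> K z) /\ L / 2 < vdm Z).
  { apply NNPP. intros H. assert (L <= L / 2); [|lra]. apply HLlub.
    intros v [Z [HZ [HK ->]]]. apply Rnot_lt_le. intros Hlt. apply H. exists Z. auto. }
  destruct HexZ as [Z [HZ [HK Hv]]]. exists Z. split; auto. split; auto.
  split; [apply vdm_pos_NoDup; lra|]. intros z q Hin.
  pose proof (sel_perm _ _ _ Hin) as HP. rewrite (vdm_perm _ _ HP) in Hv. simpl in Hv.
  assert (Hq : length q = d) by (apply Permutation_length in HP; simpl in HP; lia).
  assert (HKq : forall w, In w q -> K w).
  { intros w Hw. apply HK. eapply Permutation_in; [symmetry; apply HP|now right]. }
  destruct (classic (q = [])) as [->|Hne].
  - simpl in Hq. subst d. unfold dprod. simpl. lra.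
  (* Exchanging [z] for a point [z'] where the polynomial with roots [q] exceeds [eta^d] gives a
     product at most [L], hence less than twice the present one. *)
  - destruct (Hbig q) as [z' [Hz' Hlt]]; auto. rewrite Hq in Hlt.
    assert (HV : dprod z' q * vdm q <= L).
    { apply HLub. exists (z' :: q). split; [simpl; lia|]. split; auto.
      intros x [<-|Hx]; auto. }
    assert (Hp := vdm_nonneg q).
    assert (Hp' : 0 < vdm q).
    { destruct (Req_dec (vdm q) 0) as [E|E]; [rewrite E in Hv|]; lra. }
    apply Rnot_lt_le. intros Hc.
    assert (dprod z q * vdm q <= (eta ^ d / 2) * vdm q) by (apply Rmult_le_compat_r; lra).
    assert (eta ^ d * vdm q <= dprod z' q * vdm q) by (apply Rmult_le_compat_r; lra).
    lra.
Qed.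

End Union.

(** * Bounded coefficients on a set of positive capacity force convergence *)

Fixpoint nsum (F : nat -> ser) (m : nat) : ser :=
  match m with O => sc 0%C | S m' => (nsum F m' + F m')%ser end.

Lemma nsum_at F m g : nsum F m g = csum (fun i => F i g) m.
Proof.
  induction m as [|m IH]; simpl; [apply sc_0_at|]. unfold sadd at 1. rewrite IH. reflexivity.
Qed.

Lemma nsum_ext F G m : (forall i, (i < m)%nat -> F i = G i) -> nsum F m = nsum G m.
Proof.
  induction m as [|m IH]; intros H; simpl; [reflexivity|]. rewrite IH, H; auto.
Qed.

Lemma nsum_mul P F m : nsum (fun i => (P * F i)%ser) m = (P * nsum F m)%ser.
Proof. induction m as [|m IH]; simpl; [ring|]. rewrite IH. ring. Qed.

Lemma lift_nsum F m : lift (nsum F m) = nsum (fun i => lift (F i)) m.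
Proof.
  induction m as [|m IH]; simpl; [apply lift_sc|]. rewrite lift_add, IH. reflexivity.
Qed.

Lemma interp_nsum ka mu (c : nat -> ser) (h : nat -> C -> ser) Z m :
  interp ka mu (fun z => nsum (fun i => (c i * h i z)%ser) m) Z =
  nsum (fun i => (c i * interp ka mu (h i) Z)%ser) m.
Proof.
  induction m as [|m IH].
  - simpl. transitivity (sc 0%C * interp ka mu (fun _ => sc 1%C) Z)%ser; [|ring].
    rewrite <- interp_scal. apply interp_ext. intros. ring.
  - simpl. rewrite interp_add, IH, interp_scal. reflexivity.
Qed.

Lemma lift_sub P Q : lift (P - Q)%ser = (lift P - lift Q)%ser.
Proof.
  extensionality l. unfold ssub, sadd, sopp. destruct l as [|[|k] l]; simpl; try reflexivity. ring.
Qed.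

(** From [Q = v Q + (1 - v) Q] the norm of [Q] is at most twice that of [v Q]. Thus powers of [v]
    are cancelled without constructing an inverse. *)
Lemma snorm_unit_cancel rho b v P d : 0 < rho -> snorm rho b (sc 1%C - v)%ser <= / 2 ->
  snorm rho b P <= 2 ^ d * snorm rho b (spow v d * P)%ser.
Proof.
  intros Hr Hv.
  assert (H1 : forall Q, snorm rho b Q <= 2 * snorm rho b (v * Q)%ser).
  { intros Q. assert (snorm rho b Q <= snorm rho b (v * Q)%ser + / 2 * snorm rho b Q); [|lra].
    replace Q with (v * Q + (sc 1%C - v) * Q)%ser at 1 by ring.
    eapply Rle_trans; [apply snorm_add; auto|]. apply Rplus_le_compat_l.
    eapply Rle_trans; [apply snorm_mul; auto|]. apply Rmult_le_compat_r; auto.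
    apply snorm_nonneg; auto. }
  induction d as [|d IH]; simpl.
  - replace (sc 1%C * P)%ser with P by ring. lra.
  - replace (v * spow v d * P)%ser with (v * (spow v d * P))%ser by ring.
    specialize (H1 (spow v d * P)%ser). assert (0 < 2 ^ d) by (apply pow_lt; lra). nra.
Qed.

Lemma snorm_sprod rho b z (F : C -> ser) q W : 0 < rho -> ~ In z q ->
  (forall w, In w q -> snorm rho b (F w) <= W * / Cmod (z - w)) ->
  snorm rho b (sprod (map F q)) <= W ^ length q * / dprod z q.
Proof.
  intros Hr. induction q as [|w q IH]; intros Hz H.
  - simpl. rewrite snorm_sc, Cmod_1 by auto. unfold dprod. simpl. lra.
  - rewrite map_cons, sprod_cons, dprod_cons, Rinv_mult.
    eapply Rle_trans; [apply snorm_mul; auto|]. simpl length.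
    replace (W ^ S (length q) * (/ Cmod (z - w) * / dprod z q))
      with ((W * / Cmod (z - w)) * (W ^ length q * / dprod z q)) by (simpl; ring).
    apply Rmult_le_compat; auto using snorm_nonneg.
    + apply H. now left.
    + apply IH; intros; [intros Hin; apply Hz; now right|apply H; now right].
Qed.

Section Phi.
Variables (n : nat) (b : nat -> list nat -> C) (c1 : R).
Hypothesis c1_ge : 1 <= c1.
Hypothesis b_bound : forall j a, length a = n -> (1 <= j)%nat -> Cmod (b j a) <= c1 ^ (j + mdeg a).
Hypothesis b10 : b 1%nat (repeat 0%nat n) = RtoC 1.
Variable M : R.
Hypothesis M_ge : c1 ^ 2 * 2 ^ (n + 1) <= M.

Let rho := / (2 * M).

Lemma M_ge_c1 : c1 <= M /\ 1 <= M.
Proof.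
  assert (1 <= 2 ^ (n + 1)) by (apply pow_R1_Rle; lra).
  assert (c1 <= c1 ^ 2) by (simpl; nra).
  assert (c1 ^ 2 <= c1 ^ 2 * 2 ^ (n + 1)) by nra. lra.
Qed.

Lemma rho_spec : 0 < rho <= 1 /\ rho * M <= / 2.
Proof.
  pose proof M_ge_c1. unfold rho. repeat split.
  - apply Rinv_0_lt_compat. lra.
  - rewrite <- Rinv_1 at 1. apply Rinv_le_contravar; lra.
  - right. field. lra.
Qed.

(** The constant term cancels because [b_1(0) = 1]. Elsewhere the degree is at least 1, so one
    factor [M] absorbs [c1^2 2^(n+1)]; the geometric sums in [n] variables then give
    [2^n / 2^(n+1)]. This dictates the lower bound on [M]. *)
Lemma snorm_one_sub_b1 a : length a = n -> snorm rho a (sc 1%C - b 1%nat)%ser <= / 2.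
Proof.
  intros Ha. pose proof M_ge_c1 as HM. destruct rho_spec as [Hr HrM].
  assert (Hp : 0 < 2 ^ (n + 1)) by (apply pow_lt; lra).
  apply Rle_trans with (/ 2 ^ (n + 1) * 2 ^ length a).
  - apply (snorm_geometric _ (proj1 Hr) a _ _ M); try lra.
    + left. apply Rinv_0_lt_compat. auto.
    + intros g Hg. apply Forall2_length in Hg. rewrite Ha in Hg.
      destruct (classic (mzero g)) as [Hz|Hz].
      * rewrite (mzero_repeat n g Hg Hz). unfold ssub, sadd, sopp. rewrite b10.
        assert (E : sc 1%C (repeat 0%nat n) = 1%C).
        { unfold sc. clear. induction n as [|m IH]; auto. }
        rewrite E. replace (1 + - (1))%C with (RtoC 0) by ring. rewrite Cmod_0.
        apply Rmult_le_pos; [left; apply Rinv_0_lt_compat; auto|apply pow_le; lra].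
      * assert (E : sc 1%C g = 0%C).
        { unfold sc. destruct (forallb _ g) eqn:Ef; auto. exfalso. apply Hz.
          apply Forall_forall. intros x Hx. rewrite forallb_forall in Ef.
          specialize (Ef x Hx). apply Nat.eqb_eq in Ef. auto. }
        unfold ssub, sadd, sopp. rewrite E, Cplus_0_l, Cmod_opp.
        eapply Rle_trans; [apply b_bound; auto|].
        assert (Hd := mdeg_pos g Hz). destruct (mdeg g) as [|e]; [lia|].
        replace (c1 ^ (1 + S e)) with (c1 ^ 2 * c1 ^ e) by (simpl; ring).
        change (M ^ S e) with (M * M ^ e). rewrite <- Rmult_assoc.
        apply Rmult_le_compat; try (apply pow_le; lra).
        -- apply (Rmult_le_reg_r (2 ^ (n + 1))); auto.
           replace (/ 2 ^ (n + 1) * M * 2 ^ (n + 1)) with M by (field; lra). auto.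
        -- apply pow_incr. lra.
  - rewrite Ha, pow_add. right. simpl. field. apply pow_nonzero. lra.
Qed.

Lemma snorm_b1 a : length a = n -> snorm rho a (b 1%nat) <= 2.
Proof.
  intros Ha. destruct rho_spec as [[Hr _] _].
  replace (b 1%nat) with (sc 1%C - (sc 1%C - b 1%nat))%ser.
  - eapply Rle_trans; [apply snorm_sub; auto|]. rewrite snorm_sc, Cmod_1 by auto.
    pose proof (snorm_one_sub_b1 a Ha). lra.
  - change (b 1%nat) with (b 1%nat : ser). ring.
Qed.

Lemma snorm_phi_tail d a : length a = n -> snorm rho (d :: a) (phi_tail b) <= c1 * 2 ^ (n + 1).
Proof.
  intros Ha. pose proof M_ge_c1 as HM. destruct rho_spec as [Hr HrM].
  replace (n + 1)%nat with (length (d :: a)) by (simpl; lia).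
  apply (snorm_geometric _ (proj1 Hr) _ _ _ M); try lra.
  intros g Hg. inversion Hg as [|m ? g' ? Hm Hg' E1 E2]. subst.
  apply Forall2_length in Hg'.
  assert (0 <= c1 * M ^ mdeg (m :: g')) by (apply Rmult_le_pos; [lra|apply pow_le; lra]).
  destruct m as [|m]; simpl phi_tail; [rewrite Cmod_0; auto|].
  eapply Rle_trans; [apply b_bound; congruence || lia|].
  change (c1 ^ (S (S m) + mdeg g')) with (c1 * c1 ^ mdeg (S m :: g')).
  apply Rmult_le_compat_l; [lra|]. apply pow_incr. lra.
Qed.

Variables (f : ser3) (K : C -> Prop) (r N eta : R).
Hypothesis N_range : 0 <= N <= M.
Hypothesis K_bounded : forall z, K z -> Cmod z <= r.
Hypothesis r_nonneg : 0 <= r.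
Hypothesis eta_range : 0 < eta <= 1.
Hypothesis fekete : forall d, exists Z, length Z = S d /\ (forall z, In z Z -> K z) /\ NoDup Z /\
    forall z q, In (z, q) (sel Z) -> eta ^ d / 2 <= dprod z q.
Hypothesis coef_bound : forall z m a, K z -> length a = n -> ~ (m = 0%nat /\ mzero a) ->
  Cmod (ser_subst f (phi_s b z) m a) <= N ^ (m + mdeg a).

(** The constant coefficient is exempt from [coef_bound] and enters through [a0]. The number [W]
    bounds the norm of [u - psi - w b_1] for [|w| <= r]. *)
Let a0 := 1 + Cmod (f 0%nat 0%nat (repeat 0%nat n)).
Let W := 1 + c1 * 2 ^ (n + 1) + 2 * r.

(** The coefficient of [u^i] in [f(t u, t, x)]. *)
Definition tf (i : nat) : ser := (spow sX i * U (f i))%ser.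

(** The omitted terms carry a factor [t^i] with [i > d], so the truncation is exact up to degree [d]
    in [t]. *)
Lemma subst_trunc d z g : (hd 0 g <= d)%nat -> g <> [] ->
  nsum (fun i => (tf i * spow (phi_quot b z) i)%ser) (S d) g
  = ser_subst f (phi_s b z) (hd 0%nat g) (tl g).
Proof.
  destruct g as [|m a]; [congruence|]. intros Hm _. simpl hd in *. simpl tl.
  rewrite nsum_at, ser_subst_csum.
  rewrite (csum_ext _ (fun k => (U (f k) * spow (U (phi_s b z)) k)%ser (m :: a))).
  - apply csum_extend; [lia|]. intros i Hi. rewrite U_phi_s.
    apply smul_spow_vanish. lia.
  - intros i Hi. unfold tf. rewrite U_phi_s, spow_mul.
    apply (f_equal (fun P : ser => P (m :: a))). ring.
Qed.

Lemma snorm_subst_trunc d a z : K z -> length a = n ->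
  snorm rho (d :: a) (nsum (fun i => (tf i * spow (phi_quot b z) i)%ser) (S d))
  <= a0 * 2 ^ (n + 1).
Proof.
  intros Hz Ha. pose proof M_ge_c1 as HM. destruct rho_spec as [Hr HrM].
  assert (Ha0 : 1 <= a0).
  { unfold a0. pose proof (Cmod_ge_0 (f 0%nat 0%nat (repeat 0%nat n))). lra. }
  replace (n + 1)%nat with (length (d :: a)) by (simpl; lia).
  apply (snorm_geometric _ (proj1 Hr) _ _ _ M); try lra.
  intros g Hg. inversion Hg as [|m ? g' ? Hm Hg' E1 E2]. subst g l' y.
  apply Forall2_length in Hg'.
  rewrite subst_trunc by (simpl; auto; discriminate). simpl hd. simpl tl.
  change (mdeg (m :: g')) with (m + mdeg g')%nat.
  assert (HMp : 0 <= M ^ (m + mdeg g')) by (apply pow_le; lra).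
  destruct (classic (m = 0%nat /\ mzero g')) as [[-> Hz']|Hnz].
  - rewrite (mzero_repeat n g' (eq_trans Hg' Ha) Hz').
    rewrite ser_subst_csum. cbn [csum spow].
    assert (E : (U (f 0%nat) * sc 1%C)%ser = U (f 0%nat)) by ring.
    rewrite E.
    rewrite mdeg_repeat_0, Cplus_0_l. simpl. unfold a0. lra.
  - eapply Rle_trans; [apply coef_bound; congruence || auto|].
    apply Rle_trans with (1 * M ^ (m + mdeg g')); [|apply Rmult_le_compat_r; lra].
    rewrite Rmult_1_l. apply pow_incr. auto.
Qed.

(** The quotient [ka / mu] is the solution [s] of [u = psi + s b_1]. The new leading variable [u] is
    [sX]; [b_1] depends on [x] only and is lifted past both [t] and [u]. *)
Let ka : ser := (sX - lift (phi_tail b))%ser.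
Let mu : ser := lift (lift (b 1%nat)).

Lemma interp_subst d Z : NoDup Z -> length Z = S d ->
  interp ka mu (fun z => lift (nsum (fun i => (tf i * spow (phi_quot b z) i)%ser) (S d))) Z =
  (spow mu d * nsum (fun i => (spow sX i * lift (tf i))%ser) (S d))%ser.
Proof.
  intros Hnd Hlen.
  transitivity (interp ka mu (fun z => nsum (fun i => (lift (tf i) *
     spow (lift (phi_quot b z)) i)%ser) (S d)) Z).
  { apply interp_ext. intros z _. rewrite lift_nsum. apply nsum_ext. intros i _.
    rewrite lift_mul, lift_spow. reflexivity. }
  rewrite interp_nsum, <- nsum_mul. apply nsum_ext. intros i Hi.
  (* The power [(psi + z b_1)^i] is padded by [d - i] constant forms to degree [d]. Homogenised, the
     first forms become [mu u] and the constant ones [mu], so every [i] yields the same factor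
     [mu^d]. *)
  pose (forms := repeat (lift (phi_tail b), mu) i ++ repeat (sc 1%C, sc 0%C) (d - i)).
  assert (Hl : length forms = d) by (unfold forms; rewrite length_app, !repeat_length; lia).
  assert (E1 : forall z, spow (lift (phi_quot b z)) i = sprod (map (form_at z) forms)).
  { intros z. unfold forms. rewrite map_app, !map_repeat, sprod_app, !sprod_repeat.
    unfold form_at, fst, snd. unfold phi_quot. rewrite lift_add, lift_mul, lift_sc. fold mu.
    replace (sc 1%C + sc 0%C * sc z)%ser with (sc 1%C) by ring.
    assert (E : forall m, spow (sc 1%C) m = sc 1%C).
    { induction m as [|m IH]; simpl; [reflexivity|]. rewrite IH. ring. }
    rewrite E. ring. }
  rewrite (interp_ext _ _ _ (fun z => sprod (map (form_at z) forms))) by (intros; apply E1).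
  rewrite interp_forms by (auto; congruence).
  unfold forms. rewrite map_app, !map_repeat, sprod_app, !sprod_repeat.
  unfold fst, snd. unfold ka.
  replace (lift (phi_tail b) * mu + mu * (sX - lift (phi_tail b)))%ser with (mu * sX)%ser by ring.
  replace (sc 1%C * mu + sc 0%C * (sX - lift (phi_tail b)))%ser with mu by ring.
  rewrite spow_mul. replace d with (i + (d - i))%nat at 2 by lia. rewrite spow_add. ring.
Qed.

Lemma coef_tf_sum k j a :
  nsum (fun i => (spow sX i * lift (tf i))%ser) (S (k + j)) (k :: (k + j)%nat :: a) = f k j a.
Proof.
  rewrite nsum_at, (csum_only _ _ k); [|lia|].
  - rewrite spow_sX_mul_cons, Nat.leb_refl, Nat.sub_diag. simpl. unfold tf.
    rewrite spow_sX_mul_cons. destruct (Nat.leb_spec k (k + j)); [|lia].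
    simpl. f_equal. lia.
  - intros i Hi Hne. rewrite spow_sX_mul_cons. destruct (Nat.leb_spec i k); auto.
    simpl. destruct (Nat.eqb_spec (k - i) 0); auto. lia.
Qed.

Lemma snorm_node_ratio k d a z w : length a = n -> (z - w <> 0)%C -> Cmod w <= r ->
  snorm rho (k :: d :: a) (node_ratio ka mu z w) <= W * / Cmod (z - w).
Proof.
  intros Ha Hzw Hw. destruct rho_spec as [[Hr Hr1] _].
  unfold node_ratio. rewrite Rmult_comm.
  eapply Rle_trans; [apply snorm_mul; auto|].
  rewrite snorm_sc, Cmod_inv by auto. apply Rmult_le_compat_l.
  { left. apply Rinv_0_lt_compat, Cmod_gt_0. auto. }
  unfold node_form. eapply Rle_trans; [apply snorm_sub; auto|]. unfold W.
  apply Rplus_le_compat.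
  - unfold ka. eapply Rle_trans; [apply snorm_sub; auto|]. apply Rplus_le_compat.
    + eapply Rle_trans; [apply snorm_sX; auto|]. auto.
    + rewrite snorm_lift by auto. apply snorm_phi_tail. auto.
  - eapply Rle_trans; [apply snorm_mul; auto|]. rewrite snorm_sc by auto.
    apply Rmult_le_compat; auto using snorm_nonneg, Cmod_ge_0.
    unfold mu. rewrite !snorm_lift by auto. apply snorm_b1. auto.
Qed.

(** The factors on the right are, in order, the cost of cancelling [b_1^d], the number of nodes, the
    norm of the interpolated values, and the norm of a Lagrange basis element at the Fekete nodes,
    all with [d = k + j]. *)
Lemma fekete_coef_bound k j a : length a = n ->
  Cmod (f k j a) * rho ^ (k + (k + j) + mdeg a)
  <= 2 ^ (k + j) * (INR (S (k + j)) *
       (a0 * 2 ^ (n + 1) * (W ^ (k + j) * (2 * / eta ^ (k + j))))).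
Proof.
  intros Ha. destruct rho_spec as [[Hr Hr1] _]. set (d := (k + j)%nat).
  destruct (fekete d) as [Z [HZl [HZK [Hnd HZ]]]].
  set (be := k :: d :: a).
  assert (Hp := coef_le_snorm rho Hr be (nsum (fun i => (spow sX i * lift (tf i))%ser) (S d))).
  unfold be at 1 in Hp. unfold d at 1 2 in Hp. rewrite coef_tf_sum in Hp.
  replace (k + d + mdeg a)%nat with (mdeg be) by (unfold be, mdeg; simpl; lia).
  eapply Rle_trans; [apply Hp|].
  eapply Rle_trans; [apply (snorm_unit_cancel rho be mu _ d Hr)|].
  { unfold mu. rewrite <- (lift_sc 1%C), <- (lift_sc 1%C), <- !lift_sub.
    unfold be. rewrite !snorm_lift by auto. apply snorm_one_sub_b1. auto. }
  apply Rmult_le_compat_l; [apply pow_le; lra|].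
  rewrite <- (interp_subst d Z Hnd HZl). unfold interp.
  match goal with |- snorm _ _ (ssum (map ?F _)) <= _ =>
    replace (INR (S d)) with (INR (length (map F (sel Z))))
      by (rewrite length_map, length_sel, HZl; reflexivity) end.
  apply snorm_ssum; auto. intros P HP. apply in_map_iff in HP as [[z q] [<- Hin]].
  simpl fst. simpl snd.
  pose proof (sel_perm _ _ _ Hin) as Hperm.
  assert (Hq : length q = d) by (apply Permutation_length in Hperm; simpl in Hperm; lia).
  assert (HKq : forall w, In w (z :: q) -> K w)
    by (intros w Hw; apply HZK; eapply Permutation_in; [symmetry; apply Hperm|auto]).
  assert (Hzq : ~ In z q).
  { apply (Permutation_NoDup Hperm) in Hnd. now inversion Hnd. }
  assert (Hed : 0 < eta ^ d) by (apply pow_lt; lra).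
  specialize (HZ z q Hin).
  eapply Rle_trans; [apply snorm_mul; auto|].
  apply Rmult_le_compat; auto using snorm_nonneg.
  - unfold be. rewrite snorm_lift by auto. apply snorm_subst_trunc; auto. apply HKq. now left.
  - eapply Rle_trans; [apply (snorm_sprod rho be z _ q W); auto|].
    + intros w Hw. apply snorm_node_ratio; auto.
      * intros E. apply Ceq_minus in E. subst. auto.
      * apply K_bounded, HKq. now right.
    + rewrite Hq. apply Rmult_le_compat_l.
      { apply pow_le. unfold W. assert (0 < 2 ^ (n + 1)) by (apply pow_lt; lra). nra. }
      replace (2 * / eta ^ d) with (/ (eta ^ d / 2)) by (field; lra).
      apply Rinv_le_contravar; lra.
Qed.

Lemma convergent3_of_fekete : convergent3 n f.
Proof.
  pose proof M_ge_c1 as HM. destruct rho_spec as [[Hr Hr1] _].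
  assert (Ha0 : 1 <= a0).
  { unfold a0. pose proof (Cmod_ge_0 (f 0%nat 0%nat (repeat 0%nat n))). lra. }
  assert (Hp2 : 1 <= 2 ^ (n + 1)) by (apply pow_R1_Rle; lra).
  assert (HW : 1 <= W) by (unfold W; nra).
  (* The 4 combines the [2^d] from cancelling [b_1^d] with [d + 1 <= 2^d]. *)
  pose (Q := a0 * 2 ^ (n + 1) * 2). pose (T := 4 * W * / eta).
  assert (HQ : 1 <= Q) by (unfold Q; nra).
  assert (Hinv : 1 <= / eta) by (rewrite <- Rinv_1; apply Rinv_le_contravar; lra).
  assert (HT : 1 <= T) by (unfold T; nra).
  (* The power of [1 / rho = 2 M] has exponent [k + (k + j) + |a|], at most twice the total degree;
     hence the square. *)
  exists (Q * T * (2 * M) ^ 2). intros k j a Ha Hnz.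
  assert (He : (1 <= k + j + mdeg a)%nat).
  { destruct k; [|lia]. destruct j; [|lia]. simpl.
    apply mdeg_pos. intros Hz. apply Hnz. auto. }
  change (Cnorm (f k j a)) with (Cmod (f k j a)).
  assert (HB := fekete_coef_bound k j a Ha).
  set (d := (k + j)%nat) in *. set (e := (d + mdeg a)%nat) in *.
  assert (HB' : Cmod (f k j a) * rho ^ (k + d + mdeg a) <= Q * T ^ d).
  { eapply Rle_trans; [apply HB|]. unfold T, Q.
    rewrite !Rpow_mult_distr, pow_inv.
    replace (4 ^ d) with (2 ^ d * 2 ^ d) by (rewrite <- Rpow_mult_distr; f_equal; lra).
    assert (H := INR_S_le_pow2 d).
    set (y := a0 * 2 ^ (n + 1) * (W ^ d * (2 * / eta ^ d))).
    assert (Hy : 0 <= y).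
    { unfold y. repeat apply Rmult_le_pos; try lra; try (apply pow_le; lra).
      left. apply Rinv_0_lt_compat, pow_lt. lra. }
    apply Rle_trans with (2 ^ d * (2 ^ d * y)).
    - apply Rmult_le_compat_l; [apply pow_le; lra|]. apply Rmult_le_compat_r; auto.
    - unfold y. right. ring. }
  assert (Hrp : rho ^ (k + d + mdeg a) * (2 * M) ^ (k + d + mdeg a) = 1).
  { rewrite <- Rpow_mult_distr. unfold rho. rewrite Rinv_l by lra. apply pow1. }
  apply Rle_trans with (Q * T ^ d * (2 * M) ^ (k + d + mdeg a)).
  - rewrite <- (Rmult_1_r (Cmod _)), <- Hrp, <- Rmult_assoc.
    apply Rmult_le_compat_r; auto. apply pow_le. lra.
  - rewrite (Rpow_mult_distr (Q * T)), (Rpow_mult_distr Q T), <- pow_mult.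
    apply Rmult_le_compat; try (apply pow_le; lra).
    + apply Rmult_le_pos; [lra|apply pow_le; lra].
    + apply Rmult_le_compat; try lra; try (apply pow_le; lra).
      * rewrite <- (pow_1 Q) at 1. apply Rle_pow; auto.
      * apply Rle_pow; auto. unfold e. lia.
    + apply Rle_pow; [lra|]. unfold e, d. lia.
Qed.

End Phi.

(** * Convergence sets are F_sigma of zero capacity *)

Lemma contC_smul_at b : forall P Q : C -> ser,
  (forall g, contC (fun s => P s g)) -> (forall g, contC (fun s => Q s g)) ->
  contC (fun s => smul_at b (P s) (Q s)).
Proof.
  induction b as [|k b IH]; intros P Q HP HQ.
  - apply (contC_mul (fun s => P s []) (fun s => Q s [])); auto.
  - apply (contC_csum (fun j s => smul_at b (slice (P s) j) (slice (Q s) (k - j)))).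
    intros j. apply (IH (fun s => slice (P s) j) (fun s => slice (Q s) (k - j))); intros g;
      [apply (HP (j :: g))|apply (HQ ((k - j)%nat :: g))].
Qed.

(** This continuity makes the sets [conv_level] closed. *)
Lemma contC_ser_subst f b m a : contC (fun s => ser_subst f (phi_s b s) m a).
Proof.
  assert (Hq : forall g, contC (fun s => (sX * phi_quot b s)%ser g)).
  { intros g. apply contC_smul_at; intros h; [apply contC_const|].
    apply (contC_add (fun s => phi_tail b h) (fun s => (lift (b 1%nat) * sc s)%ser h));
      [apply contC_const|].
    apply contC_smul_at; intros h'; [apply contC_const|].
    unfold sc. destruct (forallb _ h'); [apply contC_id|apply contC_const]. }
  assert (Hp : forall k g, contC (fun s => spow (sX * phi_quot b s)%ser k g)).
  { induction k as [|k IH]; intros g; simpl; [apply contC_const|].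
    apply contC_smul_at; auto. }
  pose (g := fun s : C =>
    csum (fun k => (U (f k) * spow (sX * phi_quot b s)%ser k)%ser (m :: a)) (S m)).
  assert (Hg : contC g).
  { apply contC_csum. intros k. apply contC_smul_at; auto. intros; apply contC_const. }
  assert (E : g = (fun s => ser_subst f (phi_s b s) m a))
    by (extensionality s; unfold g; rewrite ser_subst_csum, U_phi_s; reflexivity).
  exact (eq_ind _ contC Hg _ E).
Qed.

Lemma pow_le_pow_abs x y k : Rabs x <= y -> x ^ k <= y ^ k.
Proof.
  intros H. eapply Rle_trans; [apply Rle_abs|]. rewrite <- RPow_abs.
  apply pow_incr. split; auto using Rabs_pos.
Qed.

Lemma exists_INR_ge x : exists N : nat, x <= INR N.
Proof.
  destruct (INR_unbounded x) as [N HN]. exists N. lra.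
Qed.

Lemma phi_ser_bound n b : convergent2 n (phi_ser b) ->
  exists c1, 1 <= c1 /\ forall j a, length a = n -> (1 <= j)%nat ->
    Cmod (b j a) <= c1 ^ (j + mdeg a).
Proof.
  intros [x Hx]. exists (Rmax 1 (Rabs x)). split; [apply Rmax_l|].
  intros j a Ha Hj. destruct j as [|j]; [lia|].
  eapply Rle_trans; [apply (Hx (S j) a Ha); lia|].
  apply pow_le_pow_abs, Rmax_r.
Qed.

Definition conv_level n b (f : ser3) (N : nat) (s : C) : Prop :=
  forall m a, length a = n -> ~ (m = 0%nat /\ mzero a) ->
    Cmod (ser_subst f (phi_s b s) m a) <= INR N ^ (m + mdeg a).

Lemma Conv_level n b f s : Conv n b f s <-> exists N, conv_level n b f N s.
Proof.
  split.
  - intros [x Hx]. destruct (exists_INR_ge (Rabs x)) as [N HN]. exists N.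
    intros m a Ha Hnz. eapply Rle_trans; [apply (Hx m a Ha Hnz)|].
    apply pow_le_pow_abs. auto.
  - intros [N HN]. exists (INR N). intros m a Ha Hnz. apply HN; auto.
Qed.

Lemma conv_level_closed n b f N : closedC (conv_level n b f N).
Proof.
  intros z Hz. apply NNPP. intros H. apply Hz. intros m a Ha Hnz.
  apply Rnot_lt_le. intros Hlt.
  destruct (contC_gt _ _ _ (contC_ser_subst f b m a) Hlt) as [d [Hd Hd']].
  apply H. exists d. split; auto. intros w Hw HL.
  specialize (HL m a Ha Hnz). specialize (Hd' w Hw). lra.
Qed.

Lemma Conv_Fsigma_zero_capacity n b f :
  convergent2 n (phi_ser b) -> b 1%nat (repeat 0%nat n) = RtoC 1 -> ~ convergent3 n f ->
  Fsigma_zero_capacity (Conv n b f).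
Proof.
  intros Hphi Hb10 Hdiv. split.
  { exists (conv_level n b f). split; [apply conv_level_closed|]. intros z. apply Conv_level. }
  intros r Hr K HKc HK.
  assert (HKr : forall z, K z -> Cmod z <= r) by (intros z Hz; apply HK; auto).
  apply NNPP. intros HT.
  assert (Hnc : ~ cheb_zero r K).
  { intros H. apply HT. apply (cheb_zero_transfinite_diameter r); auto. }
  assert (HexN : exists N, ~ cheb_zero r (fun z => K z /\ conv_level n b f N z)).
  { apply NNPP. intros H. apply Hnc.
    apply (cheb_zero_countable_union r K Hr HKr (fun N z => K z /\ conv_level n b f N z)); auto.
    - intros z Hz. destruct (HK z Hz) as [Hc _]. apply Conv_level in Hc as [N HN].
      exists N. auto.
    - intros N. apply NNPP. intros HN. apply H. exists N. auto. }
  destruct HexN as [N HN]. apply not_all_ex_not in HN as [eps HN].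
  apply imply_to_and in HN as [Heps HN].
  pose (K' := fun z => K z /\ conv_level n b f N z).
  assert (Hbig : forall l, l <> [] -> (forall w, In w l -> Cmod w <= r) ->
            exists z, K' z /\ eps ^ length l < dprod z l).
  { intros l Hl Hlr. apply NNPP. intros H. apply HN. exists l. split; auto. split; auto.
    intros z Hz. apply Rnot_lt_le. intros Hlt. apply H. exists z. auto. }
  apply Hdiv. destruct (phi_ser_bound n b Hphi) as [c1 [Hc1 Hb]].
  pose (eta := Rmin eps 1).
  assert (Heta : 0 < eta <= 1) by (split; [apply Rmin_glb_lt; lra|apply Rmin_r]).
  assert (HK'r : forall z, K' z -> Cmod z <= r) by (intros z [Hz _]; auto).
  assert (Hp2 : 0 < 2 ^ (n + 1)) by (apply pow_lt; lra).
  (* This [M] dominates both the growth rate [N] of the substituted series and the bound needed for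
     [b_1]. *)
  apply (convergent3_of_fekete n b c1 Hc1 Hb Hb10 (INR N + c1 ^ 2 * 2 ^ (n + 1)))
    with (K := K') (r := r) (N := INR N) (eta := eta); auto.
  - pose proof (pos_INR N). lra.
  - pose proof (pos_INR N). assert (0 <= c1 ^ 2 * 2 ^ (n + 1)) by (simpl; nra). lra.
  - apply (exists_fekete_points r K' HK'r); [lra| |].
    (* Any admissible root list exhibits a point of [K']; the single root 0 will do. *)
    + destruct (Hbig [RtoC 0]) as [z [Hz _]]; [discriminate| |exists z; auto].
      intros w [<-|[]]. rewrite Cmod_0. auto.
    + intros l Hl HlK. destruct (Hbig l Hl) as [z [Hz Hlt]]; [auto|].
      exists z. split; auto. eapply Rle_lt_trans; [|apply Hlt].
      apply pow_incr. split; [lra|apply Rmin_l].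
  - intros z m a [_ Hz] Ha Hnz. apply Hz; auto.
Qed.

(** * Products of the factors y - phi_w *)

(* [rpoly b base l k] is the coefficient of [y^k] in [base * prod_(w in l) (y - phi_w)]. *)
Fixpoint rpoly (b : nat -> list nat -> C) (base : ser) (l : list C) : nat -> ser :=
  match l with
  | [] => fun k => match k with O => base | S _ => sc 0%C end
  | w :: l' => fun k =>
      (match k with O => sc 0%C | S k' => rpoly b base l' k' end
       - U (phi_s b w) * rpoly b base l' k)%ser
  end.

Lemma rpoly_degree b base l : forall k, (length l < k)%nat -> rpoly b base l k = sc 0%C.
Proof.
  induction l as [|w l IH]; intros k Hk; simpl in *; [destruct k; [lia|reflexivity]|].
  destruct k as [|k]; [lia|]. rewrite !IH by lia. ring.
Qed.

Lemma rpoly_lead b base l : rpoly b base l (length l) = base.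
Proof.
  induction l as [|w l IH]; simpl; [reflexivity|].
  rewrite IH, (rpoly_degree _ _ _ (S (length l))) by lia. ring.
Qed.

(** With [y] weighted like [t], each factor [y - phi_w] has order 1, so the product has order at
    least [length l + e] in [(y, t)] jointly. Truncated subtraction makes the claim void for larger
    [k]. *)
Lemma rpoly_order b c e l : forall k, exists Q,
  rpoly b (c * spow sX e)%ser l k = (spow sX (length l + e - k) * Q)%ser.
Proof.
  induction l as [|w l IH]; intros k.
  - destruct k as [|k]; simpl.
    + exists c. rewrite Nat.sub_0_r. ring.
    + exists (sc 0%C). ring.
  - simpl rpoly. rewrite U_phi_s. destruct (IH k) as [Q HQ]. rewrite HQ.
    destruct k as [|k].
    + exists (sopp (phi_quot b w * Q)%ser). rewrite !Nat.sub_0_r. simpl. ring.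
    + destruct (IH k) as [Q' HQ']. rewrite HQ'.
      replace (length (w :: l) + e - S k)%nat with (length l + e - k)%nat by (simpl; lia).
      destruct (le_lt_dec (length l + e) k) as [Hle|Hlt].
      * replace (length l + e - k)%nat with 0%nat by lia.
        replace (length l + e - S k)%nat with 0%nat by lia.
        exists (Q' - sX * phi_quot b w * Q)%ser. simpl. ring.
      * replace (length l + e - k)%nat with (S (length l + e - S k)) by lia.
        exists (Q' - phi_quot b w * Q)%ser. simpl. ring.
Qed.

Lemma rpoly_vanish b c e l k j a : (k + j < length l + e)%nat ->
  rpoly b (c * spow sX e)%ser l k (j :: a) = 0%C.
Proof.
  intros H. destruct (rpoly_order b c e l k) as [Q ->]. rewrite spow_sX_mul_cons.
  destruct (Nat.leb_spec (length l + e - k) j); [lia|reflexivity].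
Qed.

Lemma nsum_first F m : nsum F (S m) = (F 0%nat + nsum (fun i => F (S i)) m)%ser.
Proof.
  induction m as [|m IH]; [simpl; ring|].
  change (nsum F (S (S m))) with (nsum F (S m) + F (S m))%ser. rewrite IH. simpl. ring.
Qed.

Lemma nsum_sub F G m : nsum (fun i => (F i - G i)%ser) m = (nsum F m - nsum G m)%ser.
Proof. induction m as [|m IH]; simpl; [ring|]. rewrite IH. ring. Qed.

Lemma rpoly_eval b base P l : forall m, (length l < m)%nat ->
  nsum (fun k => (rpoly b base l k * spow P k)%ser) m
  = (base * sprod (map (fun w : C => (P - U (phi_s b w))%ser) l))%ser.
Proof.
  induction l as [|w l IH]; intros m Hm; simpl in Hm.
  - destruct m as [|m]; [lia|]. rewrite nsum_first. simpl.
    rewrite (nsum_ext _ (fun i => (sc 0%C * spow P (S i))%ser)) by reflexivity.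
    rewrite nsum_mul. ring.
  - destruct m as [|m]; [lia|].
    rewrite (nsum_ext _ (fun k =>
      ((match k with O => sc 0%C | S k' => rpoly b base l k' end) * spow P k
       - U (phi_s b w) * (rpoly b base l k * spow P k))%ser))
      by (intros; simpl; ring).
    rewrite nsum_sub, nsum_mul, IH by lia. rewrite nsum_first.
    rewrite (nsum_ext (fun i => (rpoly b base l i * spow P (S i))%ser)
               (fun i => (P * (rpoly b base l i * spow P i))%ser))
      by (intros; simpl; ring).
    rewrite nsum_mul, IH by lia. simpl map. rewrite sprod_cons. ring.
Qed.

Lemma sprod_phi_sub b (s : C) (l : list C) :
  sprod (map (fun w : C => (U (phi_s b s) - U (phi_s b w))%ser) l) =
  (sc (cprod s l) * (spow sX (length l) * lift (spow (b 1%nat) (length l))))%ser.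
Proof.
  induction l as [|w l IH].
  - simpl. rewrite lift_sc. ring.
  - rewrite map_cons, sprod_cons, IH, !U_phi_s. simpl length. cbn [spow].
    change (cprod s (w :: l)) with ((s - w) * cprod s l)%C.
    rewrite lift_mul, sc_mul, sc_sub. unfold phi_quot. ring.
Qed.

(** * Lacunary sums of such products *)

Section Lacunary.
Variables (n : nat) (b : nat -> list nat -> C).
Variables (l : nat -> list C) (D : nat -> nat) (c : nat -> C).
Hypothesis l_pos : forall i, (0 < length (l i))%nat.
Hypothesis l_le : forall i, (length (l i) <= D i)%nat.
Hypothesis l_step : forall i, (D i < length (l (S i)))%nat.

Let e i := (D i - length (l i))%nat.
Definition piece (i : nat) : nat -> ser := rpoly b (sc (c i) * spow sX (e i))%ser (l i).

(** The piece [i] has order at least [D i > i] in [(y, t)], so stopping at [i = k + j] loses nothing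
    of the infinite sum. *)
Definition lacunary : ser3 := fun k j a => csum (fun i => piece i k (j :: a)) (S (k + j)).

Lemma D_lt_length i j : (i < j)%nat -> (D i < length (l j))%nat.
Proof.
  induction 1 as [|j Hj IH]; [apply l_step|].
  specialize (l_step j). specialize (l_le j). lia.
Qed.

Lemma D_mono i j : (i < j)%nat -> (D i < D j)%nat.
Proof. intros H. apply D_lt_length in H. specialize (l_le j). lia. Qed.

Lemma D_gt i : (i < D i)%nat.
Proof.
  induction i as [|i IH]; [specialize (l_le 0); specialize (l_pos 0); lia|].
  specialize (D_mono i (S i)). lia.
Qed.

Lemma D_inj i j : D i = D j -> i = j.
Proof.
  intros H. destruct (Nat.lt_total i j) as [Hlt|[->|Hlt]]; auto; apply D_mono in Hlt; lia.
Qed.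

Lemma piece_vanish i k j a : (k + j < D i)%nat -> piece i k (j :: a) = 0%C.
Proof. intros H. apply rpoly_vanish. unfold e. specialize (l_le i). lia. Qed.

(** Earlier pieces have smaller degree in [y], later ones have order above [D i], so the leading
    coefficient of piece [i] stands alone. Divergence is read off here. *)
Lemma lacunary_lead i : lacunary (length (l i)) (e i) (repeat 0%nat n) = c i.
Proof.
  assert (Hl := l_le i). assert (Hgt := D_gt i).
  unfold lacunary. rewrite (csum_only _ _ i).
  - unfold piece. rewrite rpoly_lead. unfold smul. rewrite smul_at_sc.
    replace (spow sX (e i)) with (spow sX (e i) * sc 1%C)%ser by ring.
    rewrite spow_sX_mul_cons, Nat.leb_refl, Nat.sub_diag.
    assert (E : sc 1%C (0%nat :: repeat 0%nat n) = RtoC 1).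
    { unfold sc. clear. simpl. induction n as [|m IH]; auto. }
    rewrite E. apply Cmult_1_r.
  - unfold e. lia.
  - intros j Hj Hne. destruct (Nat.lt_total j i) as [Hlt|[->|Hlt]]; [|congruence|].
    + unfold piece. rewrite rpoly_degree, sc_0_at; auto.
      apply D_lt_length in Hlt. specialize (l_le j). lia.
    + apply piece_vanish. apply D_mono in Hlt. unfold e. lia.
Qed.

Lemma lacunary_subst s m a :
  ser_subst lacunary (phi_s b s) m a =
  csum (fun i => if Nat.eqb (D i) m
                 then (c i * cprod s (l i) * spow (b 1%nat) (length (l i)) a)%C
                 else 0%C) (S (2 * m)).
Proof.
  rewrite ser_subst_csum. set (P := U (phi_s b s)).
  (* Exponents [k] and [j] up to [m] involve only pieces with [i <= 2 m]; a range common to all [k]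
     allows the two sums to be exchanged. *)
  transitivity (csum (fun k => csum (fun i => (piece i k * spow P k)%ser (m :: a))
                                 (S (2 * m))) (S m)).
  - apply csum_ext. intros k Hk.
    transitivity ((nsum (fun i => piece i k) (S (2 * m)) * spow P k)%ser (m :: a)).
    + unfold smul. apply smul_at_ext; [|reflexivity]. intros g Hg.
      inversion Hg as [|j ? g' ? Hj Hg' E1 E2]. rewrite nsum_at.
      change (U (lacunary k) (j :: g')) with (csum (fun i => piece i k (j :: g')) (S (k + j))).
      symmetry. apply csum_extend; [lia|]. intros i Hi. apply piece_vanish.
      pose proof (D_gt i). lia.
    + unfold smul. rewrite <- smul_at_csum_l. apply smul_at_ext; [|reflexivity].
      intros g _. apply nsum_at.
  - rewrite csum_exchange. apply csum_ext. intros i _.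
    set (d := length (l i)).
    (* The range of [k] is widened to contain the whole degree [d] of the piece; the new terms
       vanish since [P^k] has order at least [k > m] in [t]. *)
    transitivity (nsum (fun k => (piece i k * spow P k)%ser) (S (m + d)) (m :: a)).
    + rewrite nsum_at. symmetry. apply csum_extend; [lia|]. intros k Hk.
      unfold P. rewrite U_phi_s. apply smul_spow_vanish. lia.
    + unfold piece. rewrite rpoly_eval by (fold d; lia). unfold P. rewrite sprod_phi_sub. fold d.
      replace (sc (c i) * spow sX (e i) *
         (sc (cprod s (l i)) * (spow sX d * lift (spow (b 1%nat) d))))%ser
        with (sc (c i * cprod s (l i))%C * (spow sX (D i) * lift (spow (b 1%nat) d)))%ser.
      * rewrite smul_sc_at, spow_sX_mul_cons.
        destruct (Nat.eqb_spec (D i) m) as [<-|Hne].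
        -- rewrite Nat.leb_refl, Nat.sub_diag. reflexivity.
        -- destruct (Nat.leb_spec (D i) m); [|ring]. simpl.
           destruct (Nat.eqb_spec (m - D i) 0); [lia|ring].
      * replace (D i) with (e i + d)%nat by (unfold e, d; specialize (l_le i); lia).
        rewrite spow_add, sc_mul. ring.
Qed.

Lemma lacunary_subst_D s i a :
  ser_subst lacunary (phi_s b s) (D i) a
  = (c i * cprod s (l i) * spow (b 1%nat) (length (l i)) a)%C.
Proof.
  rewrite lacunary_subst, (csum_only _ _ i).
  - rewrite Nat.eqb_refl. reflexivity.
  - pose proof (D_gt i). lia.
  - intros j _ Hne. destruct (Nat.eqb_spec (D j) (D i)) as [E|]; auto.
    apply D_inj in E. congruence.
Qed.

Lemma lacunary_subst_other s m a : (forall i, D i <> m) ->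
  ser_subst lacunary (phi_s b s) m a = RtoC 0.
Proof.
  intros H. rewrite lacunary_subst. apply csum_zero. intros i _.
  destruct (Nat.eqb_spec (D i) m); auto. exfalso. eapply H; eauto.
Qed.

Hypothesis Hphi : convergent2 n (phi_ser b).
Hypothesis b10 : b 1%nat (repeat 0%nat n) = RtoC 1.

(** The power [b_1^d] has norm at most [2^d], and [d <= D i] turns this into a bound geometric in
    the degree of [t]; the Cauchy estimate supplies [(2 M)^|a|]. *)
Lemma lacunary_Conv s A : 1 <= A -> (forall i, Cmod (c i) * dprod s (l i) <= A ^ D i) ->
  Conv n b lacunary s.
Proof.
  intros HA Hs. destruct (phi_ser_bound n b Hphi) as [c1 [Hc1 Hb]].
  set (M := c1 ^ 2 * 2 ^ (n + 1)).
  assert (HM := M_ge_c1 n c1 Hc1 M (Rle_refl _)).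
  assert (Hrho := rho_spec n c1 Hc1 M (Rle_refl _)). destruct Hrho as [[Hr _] _].
  set (rho := / (2 * M)) in *.
  exists (A * 2 * (2 * M)). intros m a Ha Hnz.
  change (Cnorm (ser_subst lacunary (phi_s b s) m a))
    with (Cmod (ser_subst lacunary (phi_s b s) m a)).
  destruct (classic (exists i, D i = m)) as [[i <-]|Hno].
  - rewrite lacunary_subst_D, !Cmod_mult, Cmod_cprod. set (d := length (l i)).
    assert (H1 : Cmod (spow (b 1%nat) d a) * rho ^ mdeg a <= 2 ^ d).
    { eapply Rle_trans; [apply coef_le_snorm; auto|].
      eapply Rle_trans; [apply snorm_spow; auto|].
      apply pow_incr. split; [apply snorm_nonneg; auto|].
      apply (snorm_b1 n b c1 Hc1 Hb b10 M (Rle_refl _)). auto. }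
    assert (Hinv : rho ^ mdeg a * (2 * M) ^ mdeg a = 1).
    { rewrite <- Rpow_mult_distr. unfold rho. rewrite Rinv_l by lra. apply pow1. }
    assert (H2 : Cmod (spow (b 1%nat) d a) <= 2 ^ d * (2 * M) ^ mdeg a).
    { rewrite <- (Rmult_1_r (Cmod _)), <- Hinv, <- Rmult_assoc.
      apply Rmult_le_compat_r; auto. apply pow_le. lra. }
    apply Rle_trans with (A ^ D i * (2 ^ d * (2 * M) ^ mdeg a)).
    + apply Rmult_le_compat; auto using Cmod_ge_0.
      apply Rmult_le_pos; auto using Cmod_ge_0, dprod_nonneg.
    + rewrite (Rpow_mult_distr (A * 2)), (Rpow_mult_distr A 2), Rmult_assoc.
      specialize (l_le i). fold d in l_le.
      apply Rmult_le_compat.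
      * apply pow_le. lra.
      * apply Rmult_le_pos; apply pow_le; lra.
      * apply Rle_pow; [lra|lia].
      * apply Rmult_le_compat; try (apply pow_le; lra); apply Rle_pow; lra || lia.
  - rewrite lacunary_subst_other by (intros i Hi; apply Hno; eauto).
    rewrite Cmod_0. apply pow_le. apply Rmult_le_pos; lra.
Qed.

Lemma smul_at_repeat_0 P Q m :
  (P * Q)%ser (repeat 0%nat m) = (P (repeat 0%nat m) * Q (repeat 0%nat m))%C.
Proof.
  revert P Q. induction m as [|m IH]; intros P Q; [reflexivity|].
  transitivity (0 + (slice P 0 * slice Q 0)%ser (repeat 0%nat m))%C; [reflexivity|].
  rewrite IH. unfold slice. simpl. ring.
Qed.

(** Only the coefficients free of [x] are inspected, where [b_1(0)^d = 1]. *)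
Lemma lacunary_Conv_bound s : Conv n b lacunary s ->
  exists A, forall i, Cmod (c i) * dprod s (l i) <= A ^ D i.
Proof.
  intros [A HA]. exists A. intros i. pose proof (D_gt i).
  specialize (HA (D i) (repeat 0%nat n) (repeat_length _ _) ltac:(lia)).
  change (Cmod (ser_subst lacunary (phi_s b s) (D i) (repeat 0%nat n))
          <= A ^ (D i + mdeg (repeat 0%nat n))) in HA.
  rewrite lacunary_subst_D, mdeg_repeat_0, Nat.add_0_r in HA.
  assert (E : forall k, spow (b 1%nat) k (repeat 0%nat n) = RtoC 1).
  { induction k as [|k IH]; simpl.
    - unfold sc. clear. induction n as [|m IH]; auto.
    - rewrite smul_at_repeat_0, IH, b10. ring. }
  rewrite E, !Cmod_mult, Cmod_cprod, Cmod_1, Rmult_1_r in HA. exact HA.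
Qed.

Lemma lacunary_divergent :
  (forall A, exists i, A ^ D i < Cmod (c i)) -> ~ convergent3 n lacunary.
Proof.
  intros Hc [A HA]. destruct (Hc A) as [i Hi]. pose proof (l_pos i). pose proof (l_le i).
  specialize (HA (length (l i)) (e i) (repeat 0%nat n) (repeat_length _ _) ltac:(lia)).
  change (Cmod (lacunary (length (l i)) (e i) (repeat 0%nat n))
     <= A ^ (length (l i) + e i + mdeg (repeat 0%nat n))) in HA.
  rewrite lacunary_lead, mdeg_repeat_0 in HA.
  replace (length (l i) + e i + 0)%nat with (D i) in HA by (unfold e; lia). lra.
Qed.

End Lacunary.

(** * Every F_sigma of zero capacity is a convergence set *)

Lemma closedC_finite_union (F : nat -> C -> Prop) N :
  (forall k, closedC (F k)) -> closedC (fun z => exists k, (k <= N)%nat /\ F k z).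
Proof.
  intros HF. induction N as [|N IH]; intros z Hz.
  - destruct (HF 0%nat z) as [d [Hd H]]; [intros H; apply Hz; eauto|].
    exists d. split; auto. intros w Hw [k [Hk HFk]]. apply (H w Hw).
    replace 0%nat with k by lia. auto.
  - destruct (HF (S N) z) as [d [Hd H]]; [intros H; apply Hz; eauto|].
    destruct (IH z) as [d' [Hd' H']]; [intros [k [Hk Hk']]; apply Hz; eauto|].
    exists (Rmin d d'). split; [apply Rmin_glb_lt; auto|]. intros w Hw [k [Hk HFk]].
    destruct (Nat.eq_dec k (S N)) as [->|Hne].
    + apply (H w); auto. eapply Rlt_le_trans; [apply Hw|apply Rmin_l].
    + apply (H' w); [eapply Rlt_le_trans; [apply Hw|apply Rmin_r]|].
      exists k. split; auto. lia.
Qed.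

Definition exhaust (F : nat -> C -> Prop) (N : nat) (z : C) : Prop :=
  (exists k, (k <= N)%nat /\ F k z) /\ Cmod z <= INR N.

Lemma exhaust_closed F N : (forall k, closedC (F k)) -> closedC (exhaust F N).
Proof.
  intros HF z Hz. destruct (Rle_dec (Cmod z) (INR N)) as [Hle|Hlt].
  - destruct (closedC_finite_union F N HF z) as [d [Hd H]]; [intros H; apply Hz; split; auto|].
    exists d. split; auto. intros w Hw [Hk _]. apply (H w Hw Hk).
  - destruct (contC_gt (fun z => z) z (INR N) contC_id) as [d [Hd H]]; [lra|].
    exists d. split; auto. intros w Hw [_ Hk]. specialize (H w Hw). lra.
Qed.

(** Powers make the degree exceed [m]. When the set is empty, all roots are placed at [N + 1], at
    distance at least 1 from every point of modulus at most [N]. *)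
Lemma exhaust_roots F N eps m : transfinite_diameter_zero (exhaust F N) -> 0 < eps ->
  exists l, (m < length l)%nat /\
    (forall w, In w l -> exhaust F N w \/ INR N + 1 <= Cmod w) /\
    (forall w, In w l -> Cmod w <= INR N + 1) /\
    forall z, exhaust F N z -> dprod z l <= eps ^ length l.
Proof.
  intros HT Heps. destruct (classic (exists z, exhaust F N z)) as [[z0 Hz0]|Hno].
  - destruct (transfinite_diameter_zero_cheb _ z0 eps HT Hz0 Heps) as [l [Hl [HK Hb]]].
    assert (0 < length l)%nat by (destruct l; simpl; [congruence|lia]).
    exists (list_pow l (S m)). rewrite length_list_pow. split; [nia|]. split; [|split].
    + intros w Hw. apply In_list_pow in Hw. auto.
    + intros w Hw. apply In_list_pow, HK in Hw as [_ Hw]. lra.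
    + intros z Hz. rewrite dprod_list_pow, Nat.mul_comm, pow_mult.
      apply pow_incr. split; [apply dprod_nonneg|auto].
  - pose proof (pos_INR N).
    assert (Hc : Cmod (RtoC (INR N + 1)) = INR N + 1) by (rewrite Cmod_R; apply Rabs_pos_eq; lra).
    exists (repeat (RtoC (INR N + 1)) (S m)). rewrite repeat_length. split; [lia|].
    split; [|split].
    + intros w Hw. apply repeat_spec in Hw. subst. right. lra.
    + intros w Hw. apply repeat_spec in Hw. subst. lra.
    + intros z Hz. exfalso. eauto.
Qed.

Lemma pow2_gt_abs A N : Rabs A <= INR N -> Rabs A < 2 ^ N.
Proof.
  intros H. pose proof (INR_S_le_pow2 N) as H'. rewrite S_INR in H'. lra.
Qed.

Lemma Fsigma_zero_capacity_Conv n b E :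
  convergent2 n (phi_ser b) -> b 1%nat (repeat 0%nat n) = RtoC 1 -> Fsigma_zero_capacity E ->
  exists f : ser3, ~ convergent3 n f /\ forall s, E s <-> Conv n b f s.
Proof.
  intros Hphi Hb10 [[F [HF HE]] Hcap].
  assert (HT : forall N, transfinite_diameter_zero (exhaust F N)).
  { intros N. apply (Hcap (INR N) (pos_INR N)).
    - split; [apply exhaust_closed; auto|]. exists (INR N). intros z [_ Hz]. exact Hz.
    - intros z [[k [_ Hk]] Hz]. split; [apply HE; eauto|exact Hz]. }
  (* The index [i] codes a pair [(N, k)]; the roots of the [i]-th factor approximate the
     [N]-th set of the exhaustion, and the factor is large at distance [1/(k+1)] from it. *)
  pose (N := fun i => fst (of_nat i)). pose (L := fun i => S (snd (of_nat i))).
  (* Since [D i = L i * length (l i)], the power [eps i ^ length (l i)] is exactly the inverse of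
     the coefficient [c i]. *)
  pose (eps := fun i => / 2 ^ ((N i + 1) * L i)).
  assert (Heps : forall i, 0 < eps i) by (intros; apply Rinv_0_lt_compat, pow_lt; lra).
  assert (Hpick : forall p : nat * nat, exists l, (snd p < length l)%nat /\
    (forall w, In w l -> exhaust F (N (fst p)) w \/ INR (N (fst p)) + 1 <= Cmod w) /\
    (forall w, In w l -> Cmod w <= INR (N (fst p)) + 1) /\
    forall z, exhaust F (N (fst p)) z -> dprod z l <= eps (fst p) ^ length l).
  { intros [i m]. apply exhaust_roots; auto. }
  apply choice in Hpick as [pick Hpick].
  (* Each polynomial is chosen with degree above the previous [D], which provides the gaps. *)
  pose (l := fix l i := match i with
                        | O => pick (0%nat, 0%nat)
                        | S i' => pick (i, (L i' * length (l i'))%nat)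
                        end).
  pose (D := fun i => (L i * length (l i))%nat).
  pose (c := fun i => RtoC (2 ^ ((N i + 1) * D i))).
  assert (Hl : forall i, exists m, l i = pick (i, m)).
  { intros [|i]; [exists 0%nat|exists (L i * length (l i))%nat]; reflexivity. }
  assert (Hpos : forall i, (0 < length (l i))%nat).
  { intros i. destruct (Hl i) as [m ->]. destruct (Hpick (i, m)) as [H _]. simpl in H. lia. }
  assert (Hle : forall i, (length (l i) <= D i)%nat) by (intros i; unfold D, L; nia).
  assert (Hstep : forall i, (D i < length (l (S i)))%nat).
  { intros i. apply (Hpick (S i, (L i * length (l i))%nat)). }
  assert (Hin : forall i w, In w (l i) -> exhaust F (N i) w \/ INR (N i) + 1 <= Cmod w).
  { intros i. destruct (Hl i) as [m ->]. apply (Hpick (i, m)). }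
  assert (Hbd : forall i w, In w (l i) -> Cmod w <= INR (N i) + 1).
  { intros i. destruct (Hl i) as [m ->]. apply (Hpick (i, m)). }
  assert (Hsm : forall i z, exhaust F (N i) z -> dprod z (l i) <= eps i ^ length (l i)).
  { intros i. destruct (Hl i) as [m ->]. apply (Hpick (i, m)). }
  assert (Hc : forall i, Cmod (c i) = 2 ^ ((N i + 1) * D i)).
  { intros i. unfold c. rewrite Cmod_R. apply Rabs_pos_eq, pow_le. lra. }
  exists (lacunary b l D c). split.
  - apply lacunary_divergent; auto. intros A.
    destruct (exists_INR_ge (Rabs A)) as [m Hm]. exists (to_nat (m, 0%nat)).
    set (i := to_nat (m, 0%nat)).
    assert (HN : N i = m) by (unfold N, i; rewrite cancel_of_to; reflexivity).
    rewrite Hc, HN. eapply Rle_lt_trans; [apply (pow_le_pow_abs _ (Rabs A)); lra|].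
    rewrite pow_mult. apply pow_lt_mono.
    + split; [apply Rabs_pos|]. eapply Rlt_le_trans; [apply pow2_gt_abs, Hm|].
      apply Rle_pow; [lra|lia].
    + specialize (Hpos i). specialize (Hle i). lia.
  - intros s. split.
    + intros Hs. apply HE in Hs as [k Hk].
      destruct (exists_INR_ge (Cmod s)) as [m Hm].
      set (m0 := (k + m)%nat).
      assert (Hs0 : 0 <= Cmod s) by apply Cmod_ge_0.
      assert (Hm0 := pos_INR m0).
      assert (H2 : 1 <= 2 ^ m0) by (apply pow_R1_Rle; lra).
      (* For [N i >= m0] the point [s] lies in the set approximated and the term is at most 1. For
         smaller [N i] the coefficient is at most [(2^m0)^(D i)] and the roots lie within
         [|s| + m0 + 1] of [s]. *)
      apply (lacunary_Conv n b l D c Hpos Hle Hstep Hphi Hb10 s (2 ^ m0 * (Cmod s + INR m0 + 1)));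
        [nra|].
      intros i. rewrite Hc. destruct (le_lt_dec m0 (N i)) as [Hge|Hlt].
      * assert (Hex : exhaust F (N i) s).
        { split; [exists k; split; auto; lia|]. eapply Rle_trans; [apply Hm|].
          apply le_INR. lia. }
        apply Rle_trans with 1; [|apply pow_R1_Rle; nra].
        apply Rle_trans with (2 ^ ((N i + 1) * D i) * eps i ^ length (l i)).
        -- apply Rmult_le_compat_l; [apply pow_le; lra|]. auto.
        -- unfold eps, D. rewrite pow_inv, <- pow_mult, Nat.mul_assoc.
           right. apply Rinv_r. apply pow_nonzero. lra.
      * rewrite pow_mult, Rpow_mult_distr. rewrite <- pow_mult.
        apply Rmult_le_compat; auto using dprod_nonneg; try (apply pow_le; lra).
        -- rewrite <- pow_mult. apply Rle_pow; [lra|]. nia.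
        -- assert (HNi : INR (N i) <= INR m0) by (apply le_INR; lia).
           eapply Rle_trans; [apply (dprod_le_pow _ _ (Cmod s + INR m0 + 1))|].
           ++ intros w Hw. apply Hbd in Hw. unfold Cminus.
              eapply Rle_trans; [apply Cmod_triangle|]. rewrite Cmod_opp. lra.
           ++ apply Rle_pow; [lra|auto].
    + intros HC. apply NNPP. intros Hs.
      destruct (lacunary_Conv_bound n b l D c Hpos Hle Hstep Hb10 s HC) as [A HA].
      (* This [m] ensures [2^m > |A|], and also [|s| <= m], which keeps the roots at [m + 1] at
         distance at least 1 from [s]. *)
      destruct (exists_INR_ge (Rabs A + Cmod s)) as [m Hm].
      assert (Hs0 : 0 <= Cmod s) by apply Cmod_ge_0. assert (HA0 := Rabs_pos A).
      assert (Hns : ~ exhaust F m s) by (intros [[k [_ Hk]] _]; apply Hs, HE; eauto).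
      destruct (exhaust_closed F m HF s Hns) as [d [Hd Hd']].
      destruct (archimed_cor1 d Hd) as [k [Hk Hk0]].
      set (i := to_nat (m, k)).
      assert (HN : N i = m) by (unfold N, i; rewrite cancel_of_to; reflexivity).
      assert (HL : L i = S k) by (unfold L, i; rewrite cancel_of_to; reflexivity).
      assert (Hk1 : 0 < INR k) by (apply lt_0_INR; auto).
      assert (HSk : INR (S k) <= 2 ^ L i).
      { rewrite HL. eapply Rle_trans; [apply INR_S_le_pow2|]. apply Rle_pow; [lra|lia]. }
      (* The distance is bounded below by a power of 2 because the product over all roots is then at
         least [2^(-D i)], leaving [2^(m D i)] of the coefficient. *)
      assert (Hfar : forall w, In w (l i) -> / 2 ^ L i <= Cmod (s - w)).
      { intros w Hw. rewrite S_INR in HSk.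
        destruct (Hin i w Hw) as [Hw'|Hw']; rewrite HN in Hw'.
        - apply Rle_trans with (/ INR k); [apply Rinv_le_contravar; lra|].
          apply Rle_trans with d; [lra|]. apply Rnot_lt_le. intros Hlt.
          apply (Hd' w); auto. rewrite Cmod_sub_sym in Hlt. exact Hlt.
        - apply Rle_trans with 1.
          + rewrite <- Rinv_1. apply Rinv_le_contravar; lra.
          + assert (Cmod w <= Cmod (s - w) + Cmod s); [|lra].
            rewrite (Cmod_sub_sym s w). replace w with ((w - s) + s)%C at 1 by ring.
            apply Cmod_triangle. }
      specialize (HA i). rewrite Hc in HA.
      apply dprod_ge_pow in Hfar; [|left; apply Rinv_0_lt_compat, pow_lt; lra].
      assert (HD0 : (0 < D i)%nat) by (specialize (Hpos i); specialize (Hle i); lia).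
      assert (H1 : (2 ^ m) ^ D i <= A ^ D i).
      { eapply Rle_trans; [|apply HA].
        apply Rle_trans with (2 ^ ((N i + 1) * D i) * (/ 2 ^ L i) ^ length (l i));
          [|apply Rmult_le_compat_l; [apply pow_le; lra|auto]].
        rewrite HN, pow_inv, <- !pow_mult. fold (D i).
        replace ((m + 1) * D i)%nat with (m * D i + D i)%nat by lia.
        rewrite pow_add. right. field. apply pow_nonzero. lra. }
      assert (H2 : A ^ D i < (2 ^ m) ^ D i); [|lra].
      eapply Rle_lt_trans; [apply (pow_le_pow_abs _ (Rabs A)); lra|].
      apply pow_lt_mono; auto. split; auto. apply pow2_gt_abs. lra.
Qed.

Theorem mainTheorem1 (n : nat) (b : nat -> list nat -> Cx)
  (Hn : (1 <= n)%nat)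
  (Hphi : convergent2 n (phi_ser b))
  (Hbj : forall j, (1 <= j)%nat -> convergent_x n (b j))
  (Hb10 : b 1%nat (repeat 0%nat n) = Cone)
  (E : Cx -> Prop) :
  (exists f : ser3, ~ convergent3 n f /\ forall s, E s <-> Conv n b f s)
  <-> Fsigma_zero_capacity E.
Proof.
  split.
  - intros [f [Hdiv HE]].
    destruct (Conv_Fsigma_zero_capacity n b f Hphi Hb10 Hdiv) as [[F [HF HFE]] Hcap].
    split.
    + exists F. split; auto. intros z. rewrite HE. apply HFE.
    + intros r Hr K HK HKE. apply (Hcap r Hr K HK). intros z Hz.
      destruct (HKE z Hz) as [Hz1 Hz2]. split; auto. apply HE. auto.
  - apply (Fsigma_zero_capacity_Conv n b E Hphi Hb10).
Qed.
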